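(* Let $(M,L)$ be a pseudo-Finsler manifold with $L:A\to\mathbb{R}$, and let $\lambda:A\to(0,+\infty)$ be a smooth function, positively homogeneous of degree zero, such that $\lambda L:A\to\mathbb{R}$ is also a pseudo-Finsler metric. If the curve $\gamma:[a,b]\to M$ is a lightlike geodesic of $(M,\lambda L)$, then $\tilde\gamma=\gamma\circ\varphi$ is a lightlike geodesic of $(M,L)$, where $\varphi:[\tilde a,\tilde b]\to[a,b]$ is a solution of the differential equation $$\dot\varphi(\mu)=\lambda(\dot\gamma(\varphi(\mu))).$$
   Context: Pseudo-Finsler metrics. $M$ is a smooth manifold, $\pi:TM\to M$ the projection, $A\subset TM\setminus\mathbf 0$ open and conic ($\pi(A)=M$, and $cv\in A$ for $v\in A$, $c>0$). A smooth $L:A\to\mathbb{R}$ is a pseudo-Finsler metric if $L(cv)=c^2L(v)$ for $c>0$ and, for each $v\in A$, the fundamental tensor $g_v(u,w)=\frac12\frac{\partial^2}{\partial t\,\partial s}L(v+tu+sw)|_{t=s=0}$ is nondegenerate; $(M,L)$ is then a pseudo-Finsler manifold. The Cartan tensor is $C_v(w_1,w_2,w_3)=\frac14\frac{\partial^3}{\partial s_3\partial s_2\partial s_1}L(v+\sum_i s_iw_i)|_{s_i=0}$. Chern connection. An anisotropic connection is a map $A\times\mathfrak{X}(M)\times\mathfrak{X}(M)\to TM$, $(v,X,Y)\mapsto\nabla^v_XY\in T_{\pi(v)}M$, smooth in $v$, additive in $Y$ with $\nabla^v_X(fY)=X(f)Y_{\pi(v)}+f(\pi(v))\nabla^v_XY$,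 and $\mathcal F(M)$-linear in $X$, where $\mathcal F(M)$ denotes the smooth functions on $M$. A vector field $V$ on an open $\Omega\subset M$ is $A$-admissible if $V_p\in A$ for all $p\in\Omega$; it gives tensors $g_V,C_V$ and an affine connection $(\nabla^V_XY)_p=\nabla^{V_p}_XY$ on $\Omega$. The Chern connection of $L$ is the unique anisotropic connection $\nabla$ such that for all such $V$ and $X,Y,Z\in\mathfrak{X}(\Omega)$: $\nabla^V_XY-\nabla^V_YX=[X,Y]$ and $X(g_V(Y,Z))=g_V(\nabla^V_XY,Z)+g_V(Y,\nabla^V_XZ)+2C_V(\nabla^V_XV,Y,Z)$. Its Christoffel symbols in a chart are the functions $\Gamma^k_{ij}$ with $\nabla^v_{\partial_i}\partial_j=\Gamma^k_{ij}(v)\partial_k$. For a smooth curve $\gamma$ and a vector field $U$ along $\gamma$ with values in $A$, the covariant derivative along $\gamma$ with reference $U$ is $D^U_\gamma X=(\dot X^k+X^i\dot\gamma^j\,\Gamma^k_{ij}(U))\partial_k|_\gamma$ (Einstein convention). Curves. A smooth curve $\gamma:[a,b]\to M$ is $A$-admissible if $\dot\gamma(t)\in A$ for all $t$. It is lightlike if $L\circ\dot\gamma=0$ (equivalently $\lambda L\circ\dot\gamma=0$). A geodesic of a pseudo-Finsler manifold is a smooth $A$-admissible curve with $D^{\dot\gamma}_\gamma\dot\gamma=0$, where $D_\gamma$ is induced by the Chern connection of that pseudo-Finsler metric; so a geodesic of $(M,\lambda L)$ is defined by the Chern connection of $\lambda L$. *)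

(* Defs.v *)
From mathcomp Require Import all_boot all_order all_algebra.
From mathcomp Require Import all_classical all_reals all_analysis.

Set Implicit Arguments.
Unset Strict Implicit.
Unset Printing Implicit Defensive.

Import Order.TTheory GRing.Theory Num.Theory.
Import numFieldNormedType.Exports.

Local Open Scope classical_set_scope.
Local Open Scope ring_scope.

(* [smooth_on U f] : f is infinitely (Frechet) differentiable on U.  It is    *)
(* only used for open U, so the values of f outside of U are irrelevant.      *)
Fixpoint differentiable_order (R : realType) (V W : normedModType R) (k : nat)
    (U : set V) (f : V -> W) : Prop :=
  if k is k'.+1 then
    (forall x, U x -> differentiable f x) /\
    (forall v, differentiable_order k' U (fun x => 'D_v f x))
  else True.

Definition smooth_on (R : realType) (V W : normedModType R) (U : set V)
    (f : V -> W) : Prop :=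
  forall k, differentiable_order k U f.

(* Derivative of a function of one real variable relative to its domain D:    *)
(* one-sided at the endpoints when D is a closed interval, and independent of *)
(* the values of f outside of D.                                              *)
Definition derivable_within (R : realType) (W : normedModType R) (D : set R)
    (f : R -> W) (t : R) : Prop :=
  cvg ((fun s => (s - t)^-1 *: (f s - f t)) @ within D t^').

Definition derive_within (R : realType) (W : normedModType R) (D : set R)
    (f : R -> W) (t : R) : W :=
  lim ((fun s => (s - t)^-1 *: (f s - f t)) @ within D t^').

Fixpoint derivable_within_order (R : realType) (W : normedModType R) (k : nat)
    (D : set R) (f : R -> W) : Prop :=
  if k is k'.+1 then
    (forall t, D t -> derivable_within D f t) /\
    derivable_within_order k' D (derive_within D f)
  else True.

Definition smooth_within (R : realType) (W : normedModType R) (D : set R)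
    (f : R -> W) : Prop :=
  forall k, derivable_within_order k D f.

(* Charts and their inverses are total functions, meaningful on [chart_dom i] *)
(* and on its image.  [chart_at] picks a preferred chart around each point;   *)
(* it serves only to represent tangent vectors, see below.                    *)
Record smooth_manifold (R : realType) (n : nat) := SmoothManifold {
  point :> topologicalType ;
  chart_index : Type ;
  chart_dom : chart_index -> set point ;
  chart : chart_index -> point -> 'rV[R]_n ;
  chart_inv : chart_index -> 'rV[R]_n -> point ;
  chart_at : point -> chart_index ;
  manifold_hausdorff : hausdorff_space point ;
  manifold_second_countable : @second_countable point ;
  mem_chart_at : forall p, chart_dom (chart_at p) p ;
  open_chart_dom : forall i, open (chart_dom i) ;
  open_chart_img : forall i, open (chart i @` chart_dom i) ;
  chartK : forall i p, chart_dom i p -> chart_inv i (chart i p) = p ;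
  continuous_chart : forall i p, chart_dom i p ->
    {for p, continuous (chart i)} ;
  continuous_chart_inv : forall i x, (chart i @` chart_dom i) x ->
    {for x, continuous (chart_inv i)} ;
  smooth_transition : forall i j,
    smooth_on [set x | (chart i @` chart_dom i) x /\
                       chart_dom j (chart_inv i x)]
              (chart j \o chart_inv i)
}.

Section Manifold.
Context {R : realType} {n : nat} {M : smooth_manifold R n}.
Implicit Types (p : M) (i : chart_index M).

Definition chart_img i : set 'rV[R]_n := chart i @` chart_dom i.

(* The tangent space at p is 'rV[R]_n: a tangent vector at p is given by its  *)
(* components in the preferred chart [chart_at p].  Its components in another *)
(* chart i around p are obtained by applying the differential of the          *)
(* transition map, which is [tcoord i p].                                     *)
Definition TM : Type := (M * 'rV[R]_n)%type.

Definition tcoord i p (w : 'rV[R]_n) : 'rV[R]_n :=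
  'D_w (chart i \o chart_inv (chart_at p)) (chart (chart_at p) p).

(* The tangent vector at [chart_inv i x] with components y in the chart i:    *)
(* the inverse of the chart of TM induced by i.                               *)
Definition tvec i (xy : 'rV[R]_n * 'rV[R]_n) : TM :=
  let p := chart_inv i xy.1 in
  (p, 'D_(xy.2) (chart (chart_at p) \o chart_inv i) xy.1).

Definition tscale (c : R) (v : TM) : TM := (v.1, c *: v.2).

Definition topen (A : set TM) : Prop :=
  forall i, open [set xy : 'rV[R]_n * 'rV[R]_n |
                   chart_img i xy.1 /\ A (tvec i xy)].

Definition tsmooth_on (A : set TM) (f : TM -> R) : Prop :=
  forall i, smooth_on [set xy : 'rV[R]_n * 'rV[R]_n |
                        chart_img i xy.1 /\ A (tvec i xy)]
                      (fun xy => f (tvec i xy)).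

Definition fsmooth_on (Omega : set M) (f : M -> R) : Prop :=
  forall i, smooth_on [set x | chart_img i x /\ Omega (chart_inv i x)]
                      (fun x => f (chart_inv i x)).

(* A vector field X on Omega is a total function of which only the values     *)
(* [X p] in the tangent space at p, for p in Omega, matter.                   *)
Definition field_rep i (X : M -> 'rV[R]_n) (x : 'rV[R]_n) : 'rV[R]_n :=
  tcoord i (chart_inv i x) (X (chart_inv i x)).

Definition vector_field (Omega : set M) (X : M -> 'rV[R]_n) : Prop :=
  forall i, smooth_on [set x | chart_img i x /\ Omega (chart_inv i x)]
                      (field_rep i X).

Definition coord_field i (k : 'I_n) (p : M) : 'rV[R]_n :=
  (tvec i (chart i p, delta_mx 0 k)).2.

(* X(f) at p, computed in the chart in which X p is its own coordinates. *)
Definition field_deriv (X : M -> 'rV[R]_n) (f : M -> R) (p : M) : R :=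
  'D_(X p) (fun x => f (chart_inv (chart_at p) x)) (chart (chart_at p) p).

Definition lie_bracket (X Y : M -> 'rV[R]_n) (p : M) : 'rV[R]_n :=
  let i := chart_at p in
  'D_(X p) (field_rep i Y) (chart i p) - 'D_(Y p) (field_rep i X) (chart i p).

Record conic_domain (A : set TM) : Prop := ConicDomain {
  conic_open : topen A ;
  conic_neq0 : forall v, A v -> v.2 != 0 ;
  conic_surj : forall p, exists w, A (p, w) ;
  conic_scale : forall v (c : R), A v -> 0 < c -> A (tscale c v)
}.

Definition fundamental_tensor (L : TM -> R) (v : TM) (u w : 'rV[R]_n) : R :=
  2^-1 * derive1 (fun t : R => derive1 (fun s : R =>
           L (v.1, v.2 + t *: u + s *: w)) 0) 0.

Definition cartan_tensor (L : TM -> R) (v : TM) (w1 w2 w3 : 'rV[R]_n) : R :=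
  4^-1 * derive1 (fun s3 : R => derive1 (fun s2 : R => derive1 (fun s1 : R =>
           L (v.1, v.2 + (s1 *: w1 + s2 *: w2 + s3 *: w3))) 0) 0) 0.

(* The values of L outside of A are irrelevant since A is open. *)
Record pseudo_finsler (A : set TM) (L : TM -> R) : Prop := PseudoFinsler {
  finsler_smooth : tsmooth_on A L ;
  finsler_homogeneous : forall v (c : R), A v -> 0 < c ->
    L (tscale c v) = c ^+ 2 * L v ;
  finsler_nondegenerate : forall v, A v -> forall u,
    (forall w, fundamental_tensor L v u w = 0) -> u = 0
}.

(* [nabla v X Y] is meant for v in A and for fields X, Y defined on some open *)
(* Omega containing the base point of v, Omega being arbitrary: this includes *)
(* Omega = M, and the operation on local fields that nabla^V on X(Omega) and  *)
(* the Christoffel symbols refer to.  As vector fields are total functions,   *)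
(* the axioms on Omega force the value to depend only on the germs of X and Y *)
(* (take f = 1 on a smaller open set and f = 0 elsewhere).                    *)
Record anisotropic_connection (A : set TM)
    (nabla : TM -> (M -> 'rV[R]_n) -> (M -> 'rV[R]_n) -> 'rV[R]_n) : Prop :=
  AnisotropicConnection {
  nabla_smooth : forall (Omega : set M) X Y, open Omega ->
    vector_field Omega X -> vector_field Omega Y ->
    forall i, smooth_on [set xy : 'rV[R]_n * 'rV[R]_n |
        [/\ chart_img i xy.1, A (tvec i xy) & Omega (tvec i xy).1]]
      (fun xy => tcoord i (tvec i xy).1 (nabla (tvec i xy) X Y)) ;
  nabla_addr : forall (Omega : set M) X Y Y' v, open Omega ->
    vector_field Omega X -> vector_field Omega Y -> vector_field Omega Y' ->
    A v -> Omega v.1 ->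
    nabla v X (fun p => Y p + Y' p) = nabla v X Y + nabla v X Y' ;
  nabla_leibniz : forall (Omega : set M) X Y f v, open Omega ->
    vector_field Omega X -> vector_field Omega Y -> fsmooth_on Omega f ->
    A v -> Omega v.1 ->
    nabla v X (fun p => f p *: Y p) =
      field_deriv X f v.1 *: Y v.1 + f v.1 *: nabla v X Y ;
  nabla_addl : forall (Omega : set M) X X' Y v, open Omega ->
    vector_field Omega X -> vector_field Omega X' -> vector_field Omega Y ->
    A v -> Omega v.1 ->
    nabla v (fun p => X p + X' p) Y = nabla v X Y + nabla v X' Y ;
  nabla_scalel : forall (Omega : set M) X Y f v, open Omega ->
    vector_field Omega X -> vector_field Omega Y -> fsmooth_on Omega f ->
    A v -> Omega v.1 ->
    nabla v (fun p => f p *: X p) Y = f v.1 *: nabla v X Y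
}.

Definition admissible_field (A : set TM) (Omega : set M) (V : M -> 'rV[R]_n) :
    Prop :=
  vector_field Omega V /\ forall p, Omega p -> A (p, V p).

Record chern_connection (A : set TM) (L : TM -> R)
    (nabla : TM -> (M -> 'rV[R]_n) -> (M -> 'rV[R]_n) -> 'rV[R]_n) : Prop :=
  ChernConnection {
  chern_anisotropic : anisotropic_connection A nabla ;
  chern_torsion_free : forall (Omega : set M) V X Y p, open Omega ->
    admissible_field A Omega V ->
    vector_field Omega X -> vector_field Omega Y -> Omega p ->
    nabla (p, V p) X Y - nabla (p, V p) Y X = lie_bracket X Y p ;
  chern_almost_metric : forall (Omega : set M) V X Y Z p, open Omega ->
    admissible_field A Omega V ->
    vector_field Omega X -> vector_field Omega Y -> vector_field Omega Z ->
    Omega p ->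
    field_deriv X (fun q => fundamental_tensor L (q, V q) (Y q) (Z q)) p =
      fundamental_tensor L (p, V p) (nabla (p, V p) X Y) (Z p)
      + fundamental_tensor L (p, V p) (Y p) (nabla (p, V p) X Z)
      + 2 * cartan_tensor L (p, V p) (nabla (p, V p) X V) (Y p) (Z p)
}.

Definition christoffel
    (nabla : TM -> (M -> 'rV[R]_n) -> (M -> 'rV[R]_n) -> 'rV[R]_n)
    (c : chart_index M) (k i j : 'I_n) (v : TM) : R :=
  tcoord c v.1 (nabla v (coord_field c i) (coord_field c j)) 0 k.

(* Curves are total functions on R, restricted to a set D of parameters       *)
(* (below, D is a closed interval).                                           *)
Definition smooth_curve (D : set R) (gamma : R -> M) : Prop :=
  {within D, continuous gamma} /\
  forall i, smooth_within [set t | D t /\ chart_dom i (gamma t)]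
                          (chart i \o gamma).

Definition velocity (D : set R) (gamma : R -> M) (t : R) : 'rV[R]_n :=
  derive_within D (chart (chart_at (gamma t)) \o gamma) t.

(* D^U_gamma X at t, written in a chart c around gamma t; U and X are vector  *)
(* fields along gamma, with U s and X s in the tangent space at gamma s.      *)
Definition covariant_derivative
    (nabla : TM -> (M -> 'rV[R]_n) -> (M -> 'rV[R]_n) -> 'rV[R]_n)
    (D : set R) (gamma : R -> M) (U X : R -> 'rV[R]_n) (c : chart_index M)
    (t : R) : 'rV[R]_n :=
  let Xc s := tcoord c (gamma s) (X s) in
  let dgamma := tcoord c (gamma t) (velocity D gamma t) in
  \sum_(k < n)
    (derive_within D (fun s => Xc s 0 k) t
     + \sum_(i < n) \sum_(j < n)
         Xc t 0 i * dgamma 0 j * christoffel nabla c k i j (gamma t, U t))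
    *: coord_field c k (gamma t).

Definition admissible_curve (A : set TM) (D : set R) (gamma : R -> M) : Prop :=
  smooth_curve D gamma /\ forall t, D t -> A (gamma t, velocity D gamma t).

(* Geodesics of the metric whose Chern connection is nabla. *)
Definition geodesic (A : set TM)
    (nabla : TM -> (M -> 'rV[R]_n) -> (M -> 'rV[R]_n) -> 'rV[R]_n)
    (D : set R) (gamma : R -> M) : Prop :=
  admissible_curve A D gamma /\
  forall t c, D t -> chart_dom c (gamma t) ->
    covariant_derivative nabla D gamma (velocity D gamma) (velocity D gamma)
      c t = 0.

Definition lightlike (L : TM -> R) (D : set R) (gamma : R -> M) : Prop :=
  forall t, D t -> L (gamma t, velocity D gamma t) = 0.

End Manifold.

Arguments TM {R n} M.

(* Main.v *)
From HB Require Import structures.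
Require Import Defs.
From mathcomp Require Import all_boot all_order all_algebra.
From mathcomp Require Import all_classical all_reals all_analysis.
From mathcomp Require Import ring lra.

(** The idea is to trade the Chern connection for the Euler-Lagrange equations,
    in which replacing the metric by a conformal multiple is transparent.

    Fix a chart and write L(x, y) for the metric in the induced coordinates of
    the tangent bundle. Testing the torsion-free and almost metric identities
    of the Chern connection on fields with constant components, and using the
    homogeneity of L to discard the Cartan terms, gives [chern_spray]: if G is
    the vector of components [Gamma^k_ij y^i y^j], then
      [L_(y^k y^l) G^l = y^j L_(x^j y^k) - L_(x^k)].
    As the fundamental tensor is nondegenerate, a curve x(t) is a geodesic if and
    only if, in every chart, [(L_y(x, x'))' = L_x(x, x')]; this is
    [geodesic_euler_lagrange].

    Let now gamma be a lightlike geodesic of [N = lambda L]. Along gamma the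
    function L vanishes, so every first derivative of N is lambda times the
    derivative of L, and the equations for N read
      [(lambda L_y(x, x'))' = lambda L_x(x, x')].
    The curve gamma o phi has velocity [lambda x'], at the time [phi]. By
    homogeneity [L_y(x, lambda x') = lambda L_y(x, x')], whose derivative in the
    new parameter is, since [phi' = lambda], equal to [lambda (lambda L_x(x, x'))].
    This is [L_x(x, lambda x')] because L_x is homogeneous of degree two in y. So
    gamma o phi satisfies the equations for L, and it is lightlike because L is
    homogeneous.

    Two facts about smoothness enter besides. The change of parameter is only
    assumed to be differentiable, and it is smooth because its derivative is a
    smooth function of itself ([ode_smooth]). The curves live on closed
    intervals, so the calculus is set up for functions on an arbitrary subset
    of a normed space ([is_diff_in], [Ck], [Ck_comp]), which treats one-sided
    derivatives of curves and derivatives on open sets at the same time. *)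

Set Implicit Arguments.
Unset Strict Implicit.
Unset Printing Implicit Defensive.

Import Order.TTheory GRing.Theory Num.Theory.
Import numFieldNormedType.Exports.

Local Open Scope classical_set_scope.
Local Open Scope ring_scope.

(** * Derivatives of products and of locally equal functions *)

Section Diff.
Context {R : realType}.
Implicit Types U V W : normedModType R.

Lemma is_diff_scale V W (u du : V -> R) (f df : V -> W) x :
  is_diff x u du -> is_diff x f df ->
  is_diff x (fun y => u y *: f y) (fun v => u x *: df v + du v *: f x).
Proof.
move=> udu fdf.
have bil : bilinear_for (GRing.Scale.Law.clone _ _ *:%R _)
   (GRing.Scale.Law.clone _ _ *:%R _) (fun (k : R) (w : W) => k *: w).
  split=> [w|k] a y z /=.
  - by rewrite scalerDl scalerA.
  - by rewrite scalerDr !scalerA [a * k]mulrC.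
pose sM := bilinear_isBilinear.Build R R W W _ _ _ bil.
pose sB : {bilinear R -> W -> W} := HB.pack (fun (k : R) (w : W) => k *: w) sM.
have sc : continuous (fun p : R * W => p.1 *: p.2) by exact: scale_continuous.
have sd p : is_diff p (fun q : R * W => q.1 *: q.2) (fun q => p.1 *: q.2 + q.1 *: p.2).
  apply: DiffDef; first exact: (@differentiable_bilin _ _ _ _ sB).
  exact: (@diff_bilin _ _ _ _ sB).
exact: is_diff_comp (is_diff_pair udu fdf) (sd _).
Qed.

Lemma is_diff_derive V W (f df : V -> W) x : is_diff x f df ->
  forall v, df v = 'D_v f x.
Proof. by move=> fdf v; rewrite deriveE// diff_val. Qed.

Lemma is_diff_lin V W (f df : V -> W) x : is_diff x f df -> linear df.
Proof.
move=> fdf; have <- : 'd f x = df :> (V -> W) by exact: diff_val.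
exact: linearP.
Qed.

(** The Landau remainder unfolded into an estimate: estimates, unlike Landau
    terms, can be transported along an equality that holds only nearby. *)
Lemma is_diff_epsP V W (f : V -> W) (df : {linear V -> W}) x :
  is_diff x f df <-> continuous df /\
  forall e : R, 0 < e -> \forall h \near 0, `|f (h + x) - f x - df h| <= e * `|h|.
Proof.
split=> [fdf|[dfc fdf]].
  have [fc fE] := (diff_locallyP _ _).1 (ex_diff (is_diff_def := fdf)).
  have dE : 'd f x = df :> (V -> W) by exact: diff_val.
  rewrite dE in fE; split; first by move=> y; have := fc y; rewrite /continuous_at dE.
  move=> e e0; move/eqaddoP: fE => /(_ e e0); apply: filterS => h /=.
  by rewrite /GRing.add_fun /= opprD addrA.
have E : f \o shift x = cst (f x) + df +o_ 0 id.
  apply/eqaddoP => e e0; have := fdf e e0; apply: filterS => h /=.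
  by rewrite !fctE /= opprD addrA.
have dE : 'd f x = df :> (V -> W) by exact: diff_unique.
by apply: DiffDef => //; apply/diff_locallyP; rewrite dE.
Qed.

Lemma is_diff_near V W (f g df : V -> W) x :
  (\near x, f x = g x) -> is_diff x f df -> is_diff x g df.
Proof.
move=> fg fdf; have <- : 'd f x = df :> (V -> W) by exact: diff_val.
have /is_diff_epsP[dc de] : is_diff x f ('d f x) by apply: differentiableP.
apply/is_diff_epsP; split=> // e /de {}de.
have : \forall h \near 0, f (h + x) = g (h + x).
  by move: fg; rewrite (near_shift 0 x) /=; apply: filterS => y /=; rewrite subr0.
apply: filterS2 de => h + <-; by rewrite (nbhs_singleton fg).
Qed.

Lemma is_diff_linear_fun V W (f : {linear V -> W}) x : continuous f -> is_diff x f f.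
Proof.
by move=> fc; apply: DiffDef; [exact: linear_differentiable|exact: diff_lin].
Qed.
End Diff.

(** * Smooth maps on arbitrary sets *)

Section DiffIn.
Context {R : realType}.
Implicit Types U V W : normedModType R.

(** Differentiability of the restriction of [f] to [D], stated by extending
    [f] to a map that is differentiable at [x]. At the points of an open [D] this
    is Frechet differentiability, and at the points of a set of reals it is the
    existence of a limit of difference quotients within the set. One chain rule
    thus covers ordinary and one-sided derivatives, and it follows from the
    chain rule for the extensions. *)
Definition is_diff_in V W (D : set V) (x : V) (f df : V -> W) : Prop :=
  exists2 g, (forall y, D y -> g y = f y) & is_diff x g df.

Lemma is_diff_in_is_diff V W (D : set V) (f df : V -> W) x :
  is_diff x f df -> is_diff_in D x f df.
Proof. by exists f. Qed.

Lemma is_diff_in_subset V W (E D : set V) (f1 f2 df : V -> W) x :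
  E `<=` D -> (forall y, E y -> f1 y = f2 y) ->
  is_diff_in D x f1 df -> is_diff_in E x f2 df.
Proof.
by move=> ED f12 [g gf gd]; exists g => // y Ey; rewrite gf ?f12//; exact: ED.
Qed.

(** The extension found on a neighbourhood [U] is spliced with [f] itself
    outside of [U]. *)
Lemma is_diff_in_local V W (D U : set V) (f df : V -> W) x :
  nbhs x U -> is_diff_in (D `&` U) x f df -> is_diff_in D x f df.
Proof.
move=> xU [g gf gd]; exists (fun y => if `[< U y >] then g y else f y).
  by move=> y Dy; case: asboolP => // Uy; exact: gf.
by apply: is_diff_near gd; apply: filterS xU => y Uy; case: asboolP.
Qed.

Lemma is_diff_in_nbhs V W (D : set V) (f df : V -> W) x :
  nbhs x D -> is_diff_in D x f df -> is_diff x f df.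
Proof.
move=> xD [g gf gd]; apply: is_diff_near gd.
by apply: filterS xD => y /gf.
Qed.

Lemma is_diff_in_lin V W (D : set V) (f df : V -> W) x :
  is_diff_in D x f df -> linear df.
Proof. by case=> g _; exact: is_diff_lin. Qed.

Lemma is_diff_inD V W (D : set V) (f df g dg : V -> W) x :
  is_diff_in D x f df -> is_diff_in D x g dg ->
  is_diff_in D x (fun y => f y + g y) (fun v => df v + dg v).
Proof.
move=> [f' ff' fd] [g' gg' gd]; exists (fun y => f' y + g' y); last exact: is_diffD.
by move=> y Dy; rewrite ff'// gg'.
Qed.

Lemma is_diff_inZ V W (D : set V) (u du : V -> R) (f df : V -> W) x : D x ->
  is_diff_in D x u du -> is_diff_in D x f df ->
  is_diff_in D x (fun y => u y *: f y) (fun v => u x *: df v + du v *: f x).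
Proof.
move=> Dx [u' uu' ud] [f' ff' fd]; exists (fun y => u' y *: f' y).
  by move=> y Dy; rewrite uu'// ff'.
by rewrite -uu'// -ff'//; exact: is_diff_scale.
Qed.

Lemma is_diff_in_comp U V W (D : set U) (E : set V) (f df : U -> V)
    (g dg : V -> W) x : D x -> (forall y, D y -> E (f y)) ->
  is_diff_in D x f df -> is_diff_in E (f x) g dg ->
  is_diff_in D x (g \o f) (dg \o df).
Proof.
move=> Dx DE [f' ff' fd] [g' gg' gd]; exists (g' \o f').
  by move=> y Dy /=; rewrite ff'// gg'//; exact: DE.
by rewrite -ff'// in gd; exact: is_diff_comp.
Qed.

(** The derivative is a witness [df], with the direction as first argument,
    because at a point that [D] does not surround well enough the derivative
    is not determined by [f]. Like [smooth_on], only the derivatives in each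
    fixed direction are required to be differentiable again. *)
Fixpoint Ck V W (D : set V) (k : nat) (f : V -> W) : Prop :=
  if k is k'.+1 then exists2 df : V -> V -> W,
     forall x, D x -> is_diff_in D x f (df ^~ x) & forall v, Ck D k' (df v)
  else True.

Lemma Ck_subset V W (E D : set V) k (f g : V -> W) :
  E `<=` D -> (forall y, E y -> f y = g y) -> Ck D k f -> Ck E k g.
Proof.
elim: k f g => // k IH f g ED fg [df dfP dfC]; exists df.
  by move=> x Ex; apply: is_diff_in_subset (dfP _ (ED _ Ex)).
by move=> v; apply: IH (dfC v).
Qed.

Lemma Ck_eq V W (D : set V) k (f g : V -> W) :
  (forall y, D y -> f y = g y) -> Ck D k f -> Ck D k g.
Proof. exact: Ck_subset. Qed.

Lemma CkS V W (D : set V) k (f : V -> W) : Ck D k.+1 f -> Ck D k f.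
Proof.
elim: k f => // k IH f [df dfP dfC]; exists df => // v.
exact: IH (dfC v).
Qed.

Lemma Ck_cst V W (D : set V) k (c : W) : Ck D k (fun _ => c).
Proof.
elim: k c => // k IH c; exists (fun _ _ => 0) => // x _.
by apply: is_diff_in_is_diff; exact: is_diff_cst.
Qed.

Lemma CkD V W (D : set V) k (f g : V -> W) :
  Ck D k f -> Ck D k g -> Ck D k (fun x => f x + g x).
Proof.
elim: k f g => // k IH f g [df dfP dfC] [dg dgP dgC].
exists (fun v x => df v x + dg v x) => [x Dx|v]; last exact: IH (dfC v) (dgC v).
by apply: is_diff_inD; [exact: dfP|exact: dgP].
Qed.

Lemma CkZ V W (D : set V) k (u : V -> R) (f : V -> W) :
  Ck D k u -> Ck D k f -> Ck D k (fun x => u x *: f x).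
Proof.
elim: k u f => // k IH u f uC fC.
have [uC' fC'] := (CkS uC, CkS fC); case: uC fC => du duP duC [df dfP dfC].
exists (fun v x => u x *: df v x + du v x *: f x) => [x Dx|v].
  by apply: is_diff_inZ => //; [exact: duP|exact: dfP].
exact: CkD (IH _ _ uC' (dfC v)) (IH _ _ (duC v) fC').
Qed.

Lemma Ck_sum V W (D : set V) k I (r : seq I) (f : I -> V -> W) :
  (forall i, Ck D k (f i)) -> Ck D k (fun x => \sum_(i <- r) f i x).
Proof.
move=> fC; elim: r => [|i r IH].
  by apply: Ck_eq (Ck_cst D k (0 : W)) => y _; rewrite big_nil.
by apply: Ck_eq (CkD (fC i) IH) => y _; rewrite big_cons.
Qed.

Lemma Ck_comp_lin U V W (D : set U) k (f : U -> V) (g : {linear V -> W}) :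
  continuous g -> Ck D k f -> Ck D k (g \o f).
Proof.
move=> gc; elim: k f => // k IH f [df dfP dfC].
exists (fun v x => g (df v x)) => [x Dx|v]; last exact: IH (dfC v).
apply: (@is_diff_in_comp _ _ _ _ setT) => //; first exact: dfP.
exact/is_diff_in_is_diff/is_diff_linear_fun.
Qed.

(** A basis with continuous coordinates. It expresses the derivative of a
    composite as a sum of products of functions that are again smooth, which
    is what an induction on the order of differentiability can use. *)
Record frame V := Frame {
  frame_idx : finType ;
  frame_vec : frame_idx -> V ;
  frame_coef : frame_idx -> {linear V -> R} ;
  frame_cont : forall i, continuous (frame_coef i) ;
  frame_sum : forall v, v = \sum_i frame_coef i v *: frame_vec i }.

(** By induction on the order: the derivative of [g \o f] is the sum over a
    frame of the coordinates of the derivative of [f] times the partial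
    derivatives of [g] along [f]; both factors are smooth to one order less. *)
Lemma Ck_comp U V W (B : frame V) (D : set U) (E : set V) k (f : U -> V)
    (g : V -> W) : (forall x, D x -> E (f x)) ->
  Ck E k g -> Ck D k f -> Ck D k (g \o f).
Proof.
move=> DE; elim: k g f DE => // k IH g f DE gC fC.
have fC' := CkS fC; case: gC fC => dg dgP dgC [df dfP dfC].
exists (fun v x => \sum_i frame_coef i (df v x) *: dg (frame_vec (f:=B) i) (f x)).
  move=> x Dx; have dgx := dgP _ (DE _ Dx).
  have := is_diff_in_comp Dx DE (dfP _ Dx) dgx.
  rewrite (_ : _ \o df ^~ x =
    fun v => \sum_i frame_coef i (df v x) *: dg (frame_vec (f:=B) i) (f x)) //.
  apply/funext => v /=; rewrite {1}(frame_sum B (df v x)).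
  pose gM := GRing.isLinear.Build _ _ _ _ _ (is_diff_in_lin dgx).
  pose gL : {linear V -> W} := HB.pack (dg ^~ (f x)) gM.
  rewrite -[LHS]/(gL _) linear_sum; apply: eq_bigr => i _.
  by rewrite linearZ.
move=> v; apply: Ck_sum => i; apply: CkZ.
  exact: (Ck_comp_lin (@frame_cont _ B i) (dfC v)).
exact: (IH _ _ DE (dgC _) fC').
Qed.

Lemma Ck_pair U V W (D : set U) k (f : U -> V) (g : U -> W) :
  Ck D k f -> Ck D k g -> Ck D k (fun x => (f x, g x)).
Proof.
elim: k f g => // k IH f g [df dfP dfC] [dg dgP dgC].
exists (fun v x => (df v x, dg v x)) => [x Dx|v]; last exact: IH (dfC v) (dgC v).
have [f' ff' fd] := dfP _ Dx; have [g' gg' gd] := dgP _ Dx.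
exists (fun y => (f' y, g' y)); last exact: is_diff_pair.
by move=> y Dy; rewrite ff'// gg'.
Qed.

Definition Cinf V W (D : set V) (f : V -> W) := forall k, Ck D k f.

Lemma Cinf_comp U V W (B : frame V) (D : set U) (E : set V) (f : U -> V)
    (g : V -> W) : (forall x, D x -> E (f x)) ->
  Cinf E g -> Cinf D f -> Cinf D (g \o f).
Proof. by move=> DE gC fC k; apply: (Ck_comp B DE). Qed.

Lemma Ck_order V W (D : set V) k (f : V -> W) : open D ->
  Ck D k f <-> differentiable_order k D f.
Proof.
move=> oD; elim: k f => // k IH f; split=> [[df dfP dfC]|[df dfC]].
  have fd x : D x -> is_diff x f (df ^~ x).
    by move=> Dx; apply: is_diff_in_nbhs (dfP _ Dx); exact: open_nbhs_nbhs.
  split=> [x Dx|v]; first by case: (fd _ Dx).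
  apply/IH; apply: Ck_eq (dfC v) => y /fd h.
  exact: (is_diff_derive h).
exists (fun v x => 'D_v f x) => [x Dx|v]; last exact/IH/dfC.
apply: is_diff_in_is_diff.
rewrite (_ : (fun v => _) = 'd f x).
  by apply: differentiableP; exact: df.
by apply/funext => v; rewrite deriveE//; exact: df.
Qed.

Lemma smooth_onP V W (D : set V) (f : V -> W) : open D ->
  smooth_on D f <-> Cinf D f.
Proof. by move=> oD; split=> h k; apply/Ck_order. Qed.
End DiffIn.

(** * Functions of one real variable on a set without isolated points *)

Section Within.
Context {R : realType}.
Implicit Types U V W : normedModType R.

(** In one variable the candidate derivative is [h |-> h *: l], which is always
    linear and continuous. *)
Lemma is_diff1_epsP W (f : R -> W) (l : W) t :
  is_diff t f (fun h => h *: l) <->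
  forall e : R, 0 < e -> \forall s \near t, `|f s - f t - (s - t) *: l| <= e * `|s - t|.
Proof.
have lin : linear (fun h : R => h *: l).
  by move=> u y z; rewrite scalerDl scalerA.
pose lM := GRing.isLinear.Build _ _ _ _ _ lin.
pose L : {linear R -> W} := HB.pack (fun h : R => h *: l) lM.
have Lc : continuous L by exact: scalel_continuous.
apply: (iff_trans (is_diff_epsP f L t)); split=> [[_ h] e /h|h].
  rewrite (near_shift t 0); apply: filterS => s /=.
  by rewrite sub0r subrK.
split=> // e /h; rewrite (near_shift 0 t); apply: filterS => s /=.
by rewrite subr0 addrK.
Qed.

Lemma within_quotP W (D : set R) (f : R -> W) (l : W) t :
  (s - t)^-1 *: (f s - f t) @[s --> within D t^'] --> l <->
  forall e : R, 0 < e ->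
    \forall s \near t, D s -> `|f s - f t - (s - t) *: l| <= e * `|s - t|.
Proof.
have key s (e : R) : s != t ->
    (`|l - (s - t)^-1 *: (f s - f t)| <= e) =
    (`|f s - f t - (s - t) *: l| <= e * `|s - t|).
  move=> st; have st0 : s - t != 0 by rewrite subr_eq0.
  have -> : f s - f t - (s - t) *: l = - ((s - t) *: (l - (s - t)^-1 *: (f s - f t))).
    by rewrite scalerBr scalerA mulfV// scale1r opprB.
  by rewrite normrN normrZ (mulrC e) ler_pM2l ?normr_gt0.
split=> [/cvgrPdist_le h e /h|h].
  rewrite near_withinE /dnbhs near_withinE.
  apply: filterS => s hs Ds.
  have [->|st] := eqVneq s t; first by rewrite !subrr scale0r subrr !normr0 mulr0.
  by rewrite -key//; exact: hs.
apply/cvgrPdist_le => e /h; rewrite near_withinE /dnbhs near_withinE.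
by apply: filterS => s hs st Ds; rewrite key//; exact: hs.
Qed.

(** Outside of [D] the function can be replaced by its tangent line at [t]:
    this extension is differentiable at [t] as soon as the difference quotients
    within [D] converge. *)
Lemma within_quot_diffP W (D : set R) (f : R -> W) (l : W) t : D t ->
  (s - t)^-1 *: (f s - f t) @[s --> within D t^'] --> l <->
  is_diff_in D t f (fun h => h *: l).
Proof.
move=> Dt; split=> [/within_quotP h|[g gf /is_diff1_epsP h]].
  exists (fun s => if `[< D s >] then f s else f t + (s - t) *: l).
    by move=> y Dy; case: asboolP.
  apply/is_diff1_epsP => e e0; have := h e e0; apply: filterS => s.
  rewrite (asboolT Dt); case: asboolP => [Ds /(_ Ds)//|_ _].
  by rewrite [f t + _]addrC addrK subrr normr0 mulr_ge0// ltW.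
apply/within_quotP => e /h; apply: filterS => s + Ds.
by rewrite !gf.
Qed.

Lemma derivable_within_diff W (D : set R) (f : R -> W) t : D t ->
  derivable_within D f t -> is_diff_in D t f (fun h => h *: derive_within D f t).
Proof. by move=> Dt df; apply/within_quot_diffP. Qed.

Lemma is_diff_in_derive1 W (D : set R) (f df : R -> W) t :
  is_diff_in D t f df -> df = fun h => h *: df 1.
Proof.
move=> /is_diff_in_lin lin.
pose lM := GRing.isLinear.Build _ _ _ _ _ lin.
pose L : {linear R -> W} := HB.pack df lM.
apply/funext => h; rewrite -[in LHS](mulr1 h) -[LHS]/(L (h *: 1)).
by rewrite linearZ.
Qed.

Lemma within_dnbhs_proper (D : set R) t : limit_point D t ->
  ProperFilter (within D t^').
Proof.
move=> lD; apply: Build_ProperFilter_ex => P.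
rewrite /within /dnbhs /within /= => nP.
have [y [yt Dy Py]] := lD _ nP.
by exists y; exact: Py.
Qed.

(** An accumulation point makes the limit within the set unique. *)
Lemma derive_within_val W (D : set R) (f df : R -> W) t :
  D t -> limit_point D t -> is_diff_in D t f df ->
  derivable_within D f t /\ derive_within D f t = df 1.
Proof.
move=> Dt lD fd; have fd' := fd.
rewrite (is_diff_in_derive1 fd) in fd'.
move/(within_quot_diffP _ _ Dt) : fd' => cf.
have pf := within_dnbhs_proper lD.
split; first by apply/cvg_ex; exists (df 1).
exact: cvg_lim.
Qed.

Lemma Ck_scalel W (D : set R) k (v : R) (g : R -> W) :
  Ck D k g -> Ck D k (fun t => v *: g t).
Proof. by move=> gC; apply: CkZ => //; exact: Ck_cst. Qed.

Lemma Ck_withinP W (D : set R) k (f : R -> W) : D `<=` limit_point D ->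
  Ck D k f <-> derivable_within_order k D f.
Proof.
move=> lD; elim: k f => // k IH f; split=> [[df dfP dfC]|[df dfC]].
  split=> [t Dt|]; first by have [] := derive_within_val Dt (lD _ Dt) (dfP _ Dt).
  apply/IH; apply: Ck_eq (dfC 1) => t Dt.
  by have [_ ->] := derive_within_val Dt (lD _ Dt) (dfP _ Dt).
exists (fun v t => v *: derive_within D f t) => [t Dt|v].
  exact: derivable_within_diff (df _ Dt).
by apply: Ck_scalel; apply/IH.
Qed.

Lemma smooth_withinP W (D : set R) (f : R -> W) : D `<=` limit_point D ->
  smooth_within D f <-> Cinf D f.
Proof. by move=> lD; split=> h k; apply/(Ck_withinP _ _ lD). Qed.

(** This covers the set of times at which a curve on [D] lies in the domain of
    a chart. *)
Definition rel_open (T : topologicalType) (E D : set T) : Prop :=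
  E `<=` D /\ forall t, E t -> \forall s \near t, D s -> E s.

Lemma rel_open_limit_point (E D : set R) : rel_open E D ->
  D `<=` limit_point D -> E `<=` limit_point E.
Proof.
move=> [ED oE] lD t Et U tU.
have [y [yt Dy [Uy Ey]]] := lD _ (ED _ Et) _ (filterI tU (oE _ Et)).
by exists y; split=> //; exact: Ey.
Qed.

Lemma rel_open_is_diff_in V W (E D : set V) (f df : V -> W) t : rel_open E D ->
  E t -> is_diff_in E t f df -> is_diff_in D t f df.
Proof.
move=> [ED oE] Et fd; apply: is_diff_in_local (oE _ Et) _.
by apply: is_diff_in_subset fd => // y [Dy]; exact.
Qed.

(** Derivatives within [D] are unique, so those found on the pieces agree and
    [derive_within D f] is a global witness. *)
Lemma Ck_local W (D : set R) k (f : R -> W) : D `<=` limit_point D ->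
  (forall t, D t -> exists E, [/\ E t, rel_open E D & Ck E k f]) -> Ck D k f.
Proof.
move=> lD; elim: k f => // k IH f fl.
have fd t : D t -> exists df, is_diff_in D t f df.
  move=> /fl[E [Et oE [df dfP _]]]; exists (df ^~ t).
  exact: rel_open_is_diff_in (dfP _ Et).
exists (fun v t => v *: derive_within D f t) => [t Dt|v].
  have [df h] := fd _ Dt; apply: derivable_within_diff => //.
  by have [] := derive_within_val Dt (lD _ Dt) h.
apply: Ck_scalel; apply: IH => t /fl[E [Et oE [df dfP dfC]]].
exists E; split=> //; apply: Ck_eq (dfC 1) => y Ey.
have Dy := oE.1 _ Ey.
by have [_ ->] := derive_within_val Dy (lD _ Dy) (rel_open_is_diff_in oE Ey (dfP _ Ey)).
Qed.

Lemma is_diff_in_continuous V W (D : set V) (f df : V -> W) x : D x ->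
  is_diff_in D x f df -> f y @[y --> within D (nbhs x)] --> f x.
Proof.
move=> Dx [g gf gd]; rewrite -gf//.
have gc : {for x, continuous g} by apply: differentiable_continuous; case: gd.
have gD : g y @[y --> within D (nbhs x)] --> g x by exact: cvg_within_filter gc.
apply: cvg_trans gD; apply: near_eq_cvg.
by rewrite near_withinE; apply: nearW => y /gf.
Qed.

Lemma itvcc_limit_point (a b : R) : a < b -> `[a, b]%classic `<=` limit_point `[a, b]%classic.
Proof.
move=> ab t; rewrite /= in_itv /= => /andP[ta tb] U /nbhs_ballP[e /= e0 eU].
(* Move from t by at most e / 2 to the right or, if t = b, to the left. *)
have [tb'|bt] := ltP t b.
  exists (Num.min b (t + e / 2)).
  have te : t < t + e / 2 by rewrite ltrDl divr_gt0.
  have m1 : t < Num.min b (t + e / 2) by rewrite lt_min tb' te.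
  split; first by rewrite gt_eqF.
    by rewrite /= in_itv/= ge_min lexx andbT (le_trans ta)// ltW.
  apply: eU; rewrite /ball /= distrC gtr0_norm ?subr_gt0// ltrBlDl.
  by rewrite gt_min ltrD2l gtr_pMr// invf_lt1 ?ltr1n// orbT.
have {bt tb} tb : t = b by apply/eqP; rewrite eq_le tb.
exists (Num.max a (t - e / 2)).
have te : t - e / 2 < t by rewrite ltrBlDr ltrDl divr_gt0.
have m1 : Num.max a (t - e / 2) < t by rewrite gt_max te tb ab.
split; first by rewrite lt_eqF.
  by rewrite /= in_itv/= le_max lexx /= -tb ltW.
apply: eU; rewrite /ball /= gtr0_norm ?subr_gt0// ltrBlDl -ltrBlDr.
by rewrite lt_max ltrD2l ltrN2 gtr_pMr// invf_lt1 ?ltr1n// orbT.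
Qed.

End Within.

(** * Frames of the concrete spaces *)

Section Frames.
Context {R : realType}.
Implicit Types V W : normedModType R.

Section Coord.
Variables (n : nat) (i : 'I_n).

Definition rV_coord (v : 'rV[R]_n) : R := v 0 i.

Fact rV_coord_linear : linear rV_coord.
Proof. by move=> u y z; rewrite /rV_coord !mxE. Qed.

HB.instance Definition _ := GRing.isLinear.Build _ _ _ _ rV_coord rV_coord_linear.

Lemma rV_coord_continuous : continuous rV_coord.
Proof. exact: coord_continuous. Qed.
End Coord.

Definition rV_frame n : frame ('rV[R]_n : normedModType R) :=
  @Frame R ('rV[R]_n : normedModType R) 'I_n (fun i => delta_mx 0 i)
    (fun i => @rV_coord n i) (@rV_coord_continuous n) (@row_sum_delta R n).

Definition R_frame : frame (R : normedModType R).
Proof.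
refine (@Frame R (R : normedModType R) 'I_1 (fun=> 1) (fun=> idfun) _ _).
  by move=> i x; exact: cvg_id.
by move=> v; rewrite big_ord1 /= [_ *: _]mulr1.
Defined.

Definition pair_frame V W (B : frame V) (C : frame W) : frame (V * W)%type.
Proof.
have lin1 i : linear (fun v : V * W => frame_coef (f:=B) i v.1).
  by move=> u y z; rewrite linearP.
have lin2 i : linear (fun v : V * W => frame_coef (f:=C) i v.2).
  by move=> u y z; rewrite linearP.
pose M1 i := GRing.isLinear.Build _ _ _ _ _ (lin1 i).
pose L1 i : {linear (V * W)%type -> R} := HB.pack (fun v : V * W => frame_coef (f:=B) i v.1) (M1 i).
pose M2 i := GRing.isLinear.Build _ _ _ _ _ (lin2 i).
pose L2 i : {linear (V * W)%type -> R} := HB.pack (fun v : V * W => frame_coef (f:=C) i v.2) (M2 i).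
refine (@Frame R (V * W)%type (frame_idx B + frame_idx C)%type
  (fun i => match i with inl i => (frame_vec i, 0) | inr j => (0, frame_vec j) end)
  (fun i => match i with inl i => L1 i | inr j => L2 j end) _ _).
  case=> i x.
    apply: continuous_comp; [exact: cvg_fst|exact: frame_cont].
  apply: continuous_comp; [exact: cvg_snd|exact: frame_cont].
move=> [v w]; rewrite big_sumType /=.
rewrite {1}(frame_sum B v) {1}(frame_sum C w).
transitivity ((\sum_i frame_coef (f:=B) i v *: frame_vec i, 0 : W) +
   (0 : V, \sum_i frame_coef (f:=C) i w *: frame_vec i)).
  by congr pair; rewrite /= ?addr0 ?add0r.
congr (_ + _).
  elim: (index_enum _) => [|i r IH]; first by rewrite !big_nil.
  rewrite !big_cons -IH; congr pair => /=; by rewrite ?scaler0 ?addr0.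
elim: (index_enum _) => [|i r IH]; first by rewrite !big_nil.
rewrite !big_cons -IH; congr pair => /=; by rewrite ?scaler0 ?addr0.
Defined.
End Frames.

(** * Directional derivatives and their symmetry *)

Section Lines.
Context {R : realType}.
Implicit Types U V W : normedModType R.

Lemma is_diff_line V (p u : V) (s : R) :
  is_diff s (fun s : R => p + s *: u) (fun h => h *: u).
Proof.
have := is_diffD (is_diff_cst p s) (is_diff_scalel s u).
by congr is_diff_def; apply/funext => h; rewrite /= add0r.
Qed.

Lemma is_derive_line V W (F : V -> W) (p u : V) (s : R) :
  differentiable F (p + s *: u) ->
  is_derive s 1 (fun s : R => F (p + s *: u)) ('D_u F (p + s *: u)).
Proof.
move=> /differentiableP dF.
have h := is_diff_comp (is_diff_line p u s) dF.
apply: DeriveDef; first by apply: (@derivable1_diffP _ _ _ _).2; case: h.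
by rewrite -(is_diff_derive h) /= scale1r deriveE//; case: dF.
Qed.

Lemma derive1_line V W (F : V -> W) (p u : V) :
  derive1 (fun s : R => F (p + s *: u)) 0 = 'D_u F p.
Proof.
rewrite /derive1 /derive; set q1 := fun h : R => _; set q2 := fun h : R => _.
suff -> : q1 = q2 by [].
by apply/funext => h; rewrite /q1 /q2 /= addr0 scale0r addr0 [p + _]addrC.
Qed.

(** Both sides are limits of the same quotients, so they agree whether or not
    the limit exists. This turns the iterated derivatives that define the
    tensors of a metric into iterated directional derivatives at once. *)
Lemma derive1_lineE V W (F : V -> W) (g : R -> W) (p u : V) :
  (forall s, g s = F (p + s *: u)) -> derive1 g 0 = 'D_u F p.
Proof. by move=> /funext ->; exact: derive1_line. Qed.

Lemma deriveDl V W (F : V -> W) (p u v : V) : differentiable F p ->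
  'D_(u + v) F p = 'D_u F p + 'D_v F p.
Proof. by move=> dF; rewrite !deriveE// linearD. Qed.

Lemma deriveZl V W (F : V -> W) (p u : V) (c : R) : differentiable F p ->
  'D_(c *: u) F p = c *: 'D_u F p.
Proof. by move=> dF; rewrite !deriveE// linearZ. Qed.

Lemma derive_chain U V W (f : U -> V) (g : V -> W) (x u : U) :
  differentiable f x -> differentiable g (f x) ->
  'D_u (g \o f) x = 'D_('D_u f x) g (f x).
Proof.
move=> df dg; have h := is_diff_comp (differentiableP df) (differentiableP dg).
have hu := is_diff_derive h u; rewrite /= in hu; rewrite -hu.
by rewrite -(is_diff_derive (differentiableP df)) -(is_diff_derive (differentiableP dg)).
Qed.

Lemma mvt_line V (F : V -> R) (p u : V) (h : R) : 0 < h ->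
  (forall s, 0 <= s <= h -> differentiable F (p + s *: u)) ->
  exists2 c, 0 <= c <= h & F (p + h *: u) - F p = 'D_u F (p + c *: u) * h.
Proof.
move=> h0 dF.
have [| |c] := @MVT_segment R (fun s : R => F (p + s *: u))
    (fun s => 'D_u F (p + s *: u)) 0 h (ltW h0).
- move=> s; rewrite in_itv /= => /andP[s0 sh].
  by apply: is_derive_line; apply: dF; rewrite !ltW.
- apply: derivable_within_continuous => s; rewrite in_itv /= => sh.
  by have [] := is_derive_line (dF _ sh).
rewrite in_itv /= subr0 scale0r addr0 => ch E.
by exists c.
Qed.

(** Two applications of the mean value theorem, the first one to
    [q |-> F (q + h *: v) - F q] in the direction [u]. *)
Lemma second_difference V (F : V -> R) (p u v : V) (h : R) : 0 < h ->
  (forall s t, 0 <= s <= h -> 0 <= t <= h ->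
    differentiable F (p + s *: u + t *: v) /\
    differentiable ('D_u F) (p + s *: u + t *: v)) ->
  exists c d, [/\ 0 <= c <= h, 0 <= d <= h &
    F (p + h *: u + h *: v) - F (p + h *: u) - (F (p + h *: v) - F p) =
    'D_v ('D_u F) (p + c *: u + d *: v) * h * h].
Proof.
move=> h0 dF; have h00 : (0 : R) <= (0 : R) <= h by apply/andP; split=> //; exact: ltW.
have hh : 0 <= h <= h by apply/andP; split=> //; exact: ltW.
pose G q := F (q + h *: v) - F q.
have dG s : 0 <= s <= h -> is_diff (p + s *: u) G
    (fun w => 'D_w F (p + s *: u + h *: v) - 'D_w F (p + s *: u)).
  move=> sh; have [d1 _] := dF _ _ sh hh; have [d0 _] := dF _ _ sh h00.
  rewrite scale0r addr0 in d0.
  have dS : is_diff (p + s *: u) (fun q : V => q + h *: v) id.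
    have := is_diffD (is_diff_id (p + s *: u)) (is_diff_cst (h *: v) (p + s *: u)).
    by congr is_diff_def; apply/funext => w; rewrite /= addr0.
  have := is_diffB (is_diff_comp dS (differentiableP d1)) (differentiableP d0).
  congr is_diff_def; apply/funext => w /=.
  by rewrite !deriveE.
have [s|c ch E1] := mvt_line (F := G) (p := p) (u := u) h0.
  by move=> /dG [].
have [s sh|d dh E2] := mvt_line (F := 'D_u F) (p := p + c *: u) (u := v) h0.
  by have [] := dF _ _ ch sh.
exists c, d; split=> //; rewrite -E2.
rewrite -[LHS]/(G (p + h *: u) - G p) E1.
by rewrite -(is_diff_derive (dG _ ch)).
Qed.

Lemma norm_sub_le_half (e w1 w2 w3 : R) :
  `|w1 - w3| < e / 2 -> `|w2 - w3| < e / 2 -> `|w1 - w2| <= e.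
Proof.
rewrite !ltr_distl ler_distl => /andP[? ?] /andP[? ?].
by apply/andP; split; lra.
Qed.

(** Schwarz: the second difference of [F] over the parallelogram spanned by
    [h *: u] and [h *: v] is symmetric in [u] and [v]. It is [h ^+ 2] times a
    value of either mixed derivative near [p], and both are continuous. *)
Lemma derive_swap_scalar V (F : V -> R) (p u v : V) :
  (\near p, differentiable F p /\ differentiable ('D_u F) p /\
            differentiable ('D_v F) p) ->
  {for p, continuous ('D_v ('D_u F))} -> {for p, continuous ('D_u ('D_v F))} ->
  'D_v ('D_u F) p = 'D_u ('D_v F) p.
Proof.
move=> dF cvu cuv; apply/eqP; rewrite -subr_eq0 -normr_le0.
apply/ler_addgt0Pl => e e0; rewrite addr0.
have e2 : 0 < e / 2 by rewrite divr_gt0.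
have /cvgrPdist_lt/(_ _ e2) nvu := cvu.
have /cvgrPdist_lt/(_ _ e2) nuv := cuv.
have /nbhs_ballP[r /= r0 br] : nbhs p [set q |
   (differentiable F q /\ differentiable ('D_u F) q /\ differentiable ('D_v F) q) /\
   (`|'D_v ('D_u F) p - 'D_v ('D_u F) q| < e / 2 /\
    `|'D_u ('D_v F) p - 'D_u ('D_v F) q| < e / 2)].
  exact: filterI dF (filterI nvu nuv).
(* Small enough for the parallelogram of side h to lie in the ball of radius r. *)
pose h := r / (`|u| + `|v| + 1).
have n0 : 0 < `|u| + `|v| + 1 by rewrite ltr_wpDl// addr_ge0.
have h0 : 0 < h by rewrite divr_gt0.
have inb s t : 0 <= s <= h -> 0 <= t <= h -> ball p r (p + s *: u + t *: v).
  move=> /andP[s0 sh] /andP[t0 th].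
  rewrite -ball_normE /= -addrA opprD addNKr normrN.
  apply: (le_lt_trans (ler_normD _ _)); rewrite !normrZ !ger0_norm//.
  apply: (@le_lt_trans _ _ (h * (`|u| + `|v|))).
    by rewrite mulrDr lerD// ler_wpM2r.
  by rewrite /h mulrAC ltr_pdivrMr// ltr_pM2l// ltrDl.
have inb' s t : 0 <= s <= h -> 0 <= t <= h -> ball p r (p + s *: v + t *: u).
  by move=> sh th; rewrite addrAC; exact: inb.
have [s t sh th|c [d [ch dh E1]]] := second_difference (F := F) (p := p) (u := u) (v := v) h0.
  by have [[? [? _]] _] := br _ (inb _ _ sh th).
have [s t sh th|c' [d' [ch' dh' E2]]] := second_difference (F := F) (p := p) (u := v) (v := u) h0.
  by have [[? [_ ?]] _] := br _ (inb' _ _ sh th).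
have E : 'D_v ('D_u F) (p + c *: u + d *: v) = 'D_u ('D_v F) (p + c' *: v + d' *: u).
  have hn : h != 0 by rewrite gt_eqF.
  have Q : p + h *: u + h *: v = p + h *: v + h *: u by rewrite addrAC.
  rewrite Q in E1.
  have E12 := etrans (esym E1) (etrans _ E2).
  apply: (mulIf hn); apply: (mulIf hn); apply: E12.
  move: (F _) (F (p + h *: u)) (F (p + h *: v)) (F p) => w1 w2 w3 w4.
  by ring.
have [_ [b1 _]] := br _ (inb _ _ ch dh).
have [_ [_ b2]] := br _ (inb' _ _ ch' dh').
rewrite /= in b1 b2; rewrite -E in b2.
move: b1 b2; move: ('D_v ('D_u F) p) ('D_u ('D_v F) p) ('D_v ('D_u F) _) => w1 w2 w3.
exact: norm_sub_le_half.
Qed.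

Lemma smooth_on_derive V W (D : set V) (f : V -> W) v :
  smooth_on D f -> smooth_on D ('D_v f).
Proof. by move=> fs k; have [_] := fs k.+1; apply. Qed.

Lemma smooth_on_diff V W (D : set V) (f : V -> W) x :
  smooth_on D f -> D x -> differentiable f x.
Proof. by move=> fs; have [+ _] := fs 1%N; apply. Qed.

Lemma derive_swap V n (D : set V) (F : V -> 'rV[R]_n) (p u v : V) :
  open D -> D p -> smooth_on D F ->
  'D_v ('D_u F) p = 'D_u ('D_v F) p.
Proof.
move=> oD Dp sF; apply/rowP => j.
pose c : {linear 'rV[R]_n -> R} := @rV_coord R n j.
have cc : continuous c by exact: rV_coord_continuous.
have Dc w (G : V -> 'rV[R]_n) q : differentiable G q ->
    'D_w (c \o G) q = c ('D_w G q).
  move=> dG; have h := is_diff_comp (differentiableP dG) (is_diff_linear_fun (G q) cc).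
  by rewrite -(is_diff_derive h) /= deriveE.
have nD : \near p, D p by exact: open_nbhs_nbhs.
have sD w : smooth_on D ('D_w F) := smooth_on_derive w sF.
have sDD w w' : smooth_on D ('D_w ('D_w' F)) := smooth_on_derive w (sD _).
have eqDD w w' q : D q -> 'D_w ('D_w' (c \o F)) q = c ('D_w ('D_w' F) q).
  move=> Dq; rewrite -Dc; last exact: (smooth_on_diff (sD _)).
  apply: near_eq_derive.
  have : nbhs q D by exact: open_nbhs_nbhs.
  apply: filterS => y Dy; apply: Dc; exact: (smooth_on_diff sF).
have dc (G : V -> 'rV[R]_n) q : differentiable G q -> differentiable (c \o G) q.
  by move=> /differentiable_comp; apply; apply: linear_differentiable.
have cDD w w' : {for p, continuous ('D_w ('D_w' (c \o F)))}.
  have : {for p, continuous (c \o ('D_w ('D_w' F)))}.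
    apply: differentiable_continuous; apply: dc.
    exact: (smooth_on_diff (sDD _ _)).
  rewrite /prop_for /continuous_at /= eqDD// => h.
  apply: cvg_trans h; apply: near_eq_cvg; apply: filterS nD => q Dq /=.
  by rewrite eqDD.
have dd w q : D q -> differentiable ('D_w (c \o F)) q.
  move=> Dq.
  have h : is_diff q (c \o 'D_w F) ('d (c \o 'D_w F) q).
    by apply: differentiableP; apply: dc; exact: (smooth_on_diff (sD _)).
  have E : \near q, (c \o 'D_w F) q = 'D_w (c \o F) q.
    have : nbhs q D by exact: open_nbhs_nbhs.
    by apply: filterS => y Dy; rewrite /= Dc//; exact: (smooth_on_diff sF).
  by case: (is_diff_near E h).
have dn : \near p, differentiable (c \o F) p /\
    differentiable ('D_u (c \o F)) p /\ differentiable ('D_v (c \o F)) p.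
  apply: filterS nD => q Dq; split; last by split; exact: dd.
  by apply: dc; exact: (smooth_on_diff sF).
have := derive_swap_scalar dn (cDD _ _) (cDD _ _).
by rewrite (eqDD _ _ _ Dp) (eqDD _ _ _ Dp).
Qed.
End Lines.

(** * Fibrewise homogeneous functions *)

Section Homogeneous.
Context {R : realType} {X Y : normedModType R}.
Variable A : set (X * Y).
Hypothesis oA : open A.
Hypothesis coneA : forall (x : X) (y : Y) (c : R), A (x, y) -> 0 < c -> A (x, c *: y).
Implicit Types (F : X * Y -> R) (x : X) (y w : Y) (c : R).

Definition fibre_homogeneous (k : nat) F : Prop :=
  forall x y c, A (x, y) -> 0 < c -> F (x, c *: y) = c ^+ k * F (x, y).

Let nA q : A q -> \near q, A q.
Proof. by move=> Aq; exact: open_nbhs_nbhs. Qed.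

Lemma is_diff_fibre_scale c (q : X * Y) :
  is_diff q (fun q : X * Y => (q.1, c *: q.2)) (fun v => (v.1, c *: v.2)).
Proof.
have lin : linear (fun q : X * Y => (q.1, c *: q.2)).
  move=> a u v; congr pair => /=.
  by rewrite scalerDr !scalerA mulrC.
pose M := GRing.isLinear.Build _ _ _ _ _ lin.
pose L : {linear (X * Y)%type -> (X * Y)%type} := HB.pack (fun q : X * Y => (q.1, c *: q.2)) M.
have Lc : continuous L.
  move=> p; apply: cvg_pair => /=; first exact: cvg_fst.
  apply: (@continuous_comp _ _ _ snd ( *:%R c)); first exact: cvg_snd.
  exact: scaler_continuous.
exact: (is_diff_linear_fun (f := L)).
Qed.

(** The derivative of [F (x, c *: y) = c ^+ k * F (x, y)], seen as an identity
    between functions of [(x, y)]. *)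
Lemma derive_homogeneous k F x y (a : X) (b : Y) c :
  fibre_homogeneous k F -> (forall q, A q -> differentiable F q) ->
  A (x, y) -> 0 < c ->
  'D_(a, c *: b) F (x, c *: y) = c ^+ k * 'D_(a, b) F (x, y).
Proof.
move=> hF dF Axy c0.
have dS := is_diff_fibre_scale c (x, y).
have dFc := dF _ (coneA Axy c0).
have E : 'D_(a, b) (F \o (fun q => (q.1, c *: q.2))) (x, y) = 'D_(a, c *: b) F (x, c *: y).
  have dS1 : differentiable (fun q : X * Y => (q.1, c *: q.2)) (x, y) by case: dS.
  by rewrite (derive_chain _ dS1 dFc) -(is_diff_derive dS).
rewrite -E (_ : 'D_(a, b) _ _ = 'D_(a, b) (c ^+ k \*: F) (x, y)).
  rewrite deriveZ//; apply: diff_derivable; exact: dF.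
apply: near_eq_derive; apply: filterS (nA Axy) => -[x' y'] A' /=.
exact: hF.
Qed.

Lemma fibre_derive_homogeneous k F w :
  fibre_homogeneous k.+1 F -> (forall q, A q -> differentiable F q) ->
  fibre_homogeneous k ('D_(0, w) F).
Proof.
move=> hF dF x y c Axy c0.
have := derive_homogeneous 0 w hF dF Axy c0.
rewrite (_ : (0, c *: w) = c *: (0, w) :> (X * Y)%type); last first.
  by congr pair; rewrite /= scaler0.
rewrite deriveZl; last exact/dF/coneA.
rewrite exprS -mulrA => /mulfI -> //; exact: lt0r_neq0.
Qed.

(** Euler's identity: the derivative of [(1 + s) ^+ k * F (x, y)] at [s = 0]. *)
Lemma euler_homogeneous k F x y :
  fibre_homogeneous k F -> (forall q, A q -> differentiable F q) ->
  A (x, y) -> 'D_(0, y) F (x, y) = k%:R * F (x, y).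
Proof.
move=> hF dF Axy; rewrite -derive1_line derive1E.
have E : \forall s \near (0 : R), (1 + s) ^+ k * F (x, y) = F ((x, y) + s *: (0, y)).
  have : \forall s \near (0 : R), -1 < s by exact: (lt_nbhsr (ltrN10 R)).
  apply: filterS => s s1.
  rewrite -hF//; last by lra.
  by congr (F (_, _)) => /=; rewrite ?scaler0 ?addr0// scalerDl scale1r.
rewrite -(near_eq_derive _ E).
have -> : (fun s : R => (1 + s) ^+ k * F (x, y)) = F (x, y) \*: ((cst 1 + id) ^+ k).
  apply/funext => s; rewrite /= mulrC; congr (_ * _).
  by rewrite fctE.
rewrite deriveZ// deriveX// deriveD// derive_cst derive_id add0r.
rewrite (_ : (cst 1 + id) 0 = 1 :> R); last by rewrite !fctE addr0.
by rewrite expr1n !mulr1 [_%:A]mulr1 [RHS]mulrC.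
Qed.

(** Here the direction [y] of the inner derivative stays fixed while the base
    point moves. Along [y + s *: w], Euler's identity reads
    ['D_(0, y) F = k * F - s * 'D_(0, w) F], and this is differentiated at
    [s = 0]. *)
Lemma derive_euler k F x y w :
  fibre_homogeneous k F -> (forall q, A q -> differentiable F q) ->
  A (x, y) -> differentiable ('D_(0, w) F) (x, y) ->
  'D_(0, w) ('D_(0, y) F) (x, y) = k%:R * 'D_(0, w) F (x, y) - 'D_(0, w) F (x, y).
Proof.
move=> hF dF Axy dwF; rewrite -derive1_line derive1E.
pose l (s : R) := (x, y) + s *: ((0, w) : X * Y).
have l0 : l 0 = (x, y) by rewrite /l scale0r addr0.
have dl : differentiable l 0 by case: (is_diff_line (x, y) ((0, w) : X * Y) 0).
have lA : \forall s \near (0 : R), A (l s).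
  apply: (differentiable_continuous dl); rewrite l0; exact: nA.
have E : \forall s \near (0 : R),
    k%:R * F (l s) - s * 'D_(0, w) F (l s) = 'D_(0, y) F ((x, y) + s *: (0, w)).
  apply: filterS lA => s Als; rewrite -/(l s).
  have lE : l s = (x, y + s *: w) by congr pair; rewrite /= scaler0 addr0.
  have := @euler_homogeneous k F x (y + s *: w) hF dF; rewrite -lE => /(_ Als) <-.
  rewrite (_ : (0, y + s *: w) = (0, y) + s *: (0, w) :> (X * Y)%type); last first.
    by congr pair; rewrite /= ?scaler0 ?addr0.
  rewrite deriveDl; last exact: dF.
  by rewrite deriveZl; [rewrite addrK|exact: dF].
rewrite -(near_eq_derive _ E).
have dFl : is_derive (0 : R) (1 : R) (F \o l : R -> R) ('D_(0, w) F (x, y)).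
  have := @is_derive_line _ _ _ F (x, y) (0, w) 0.
  by rewrite -/(l 0) l0; apply; exact: dF.
have dwFl : derivable (('D_(0, w) F) \o l : R -> R) 0 1.
  apply: diff_derivable; apply: differentiable_comp => //.
  by rewrite l0.
have -> : (fun s => k%:R * F (l s) - s * 'D_(0, w) F (l s)) =
    (k%:R \*: (F \o l)) - (id * (('D_(0, w) F) \o l)).
  by apply/funext => s; rewrite !fctE.
have h := is_deriveB (is_deriveZ k%:R dFl)
  (is_deriveM (is_derive_id (0 : R) (1 : R)) (derivableP dwFl)).
have {h} [_ ->] := h.
by rewrite /= l0 scale0r add0r [_ *: 1]mulr1.
Qed.
End Homogeneous.

(** * Charts and fields with constant components *)

Section Charts.
Context {R : realType} {n : nat} {M : smooth_manifold R n}.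
Implicit Types (p : M) (i j k c : chart_index M) (x y z u w : 'rV[R]_n).

Definition transition i j := chart j \o chart_inv i.

Lemma chart_img_chart i p : chart_dom i p -> chart_img i (chart i p).
Proof. by exists p. Qed.

Lemma chart_imgP i x : chart_img i x ->
  chart_dom i (chart_inv i x) /\ chart i (chart_inv i x) = x.
Proof. by case=> p ip <-; rewrite chartK. Qed.

Lemma open_chart_preimage i (Omega : set M) : open Omega ->
  open [set x | chart_img i x /\ Omega (chart_inv i x)].
Proof.
move=> oO; rewrite openE => x [ix Ox]; rewrite /interior.
have n1 : nbhs x (chart_img i) by apply: open_nbhs_nbhs; split=> //; exact: open_chart_img.
have n2 : nbhs x (chart_inv i @^-1` Omega).
  by apply: (continuous_chart_inv ix); exact: open_nbhs_nbhs.
exact: filterI.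
Qed.

Lemma transition_diff i j p : chart_dom i p -> chart_dom j p ->
  differentiable (transition i j) (chart i p).
Proof.
move=> ip jp; apply: (smooth_on_diff (@smooth_transition _ _ M i j)).
by split; [exact: chart_img_chart|rewrite chartK].
Qed.

Lemma near_chart_inv c p (P : set M) : chart_dom c p -> nbhs p P ->
  \forall x \near chart c p, chart_img c x /\ P (chart_inv c x).
Proof.
move=> cp pP; have ci := chart_img_chart cp.
have n1 : nbhs (chart c p) (chart_img c).
  by apply: open_nbhs_nbhs; split=> //; exact: open_chart_img.
have n2 : nbhs (chart c p) (chart_inv c @^-1` P).
  by apply: (continuous_chart_inv ci); rewrite chartK.
exact: filterI.
Qed.

Lemma near_chart_dom i j p : chart_dom i p -> chart_dom j p ->
  \forall x \near chart i p, chart_img i x /\ chart_dom j (chart_inv i x).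
Proof.
move=> ip jp; apply: near_chart_inv => //; apply: open_nbhs_nbhs.
by split=> //; exact: open_chart_dom.
Qed.

Lemma near_transition_comp (T : Type) i j (f : M -> T) p : chart_dom i p -> chart_dom j p ->
  \forall x \near chart i p, ((f \o chart_inv j) \o transition i j) x = (f \o chart_inv i) x.
Proof.
move=> ip jp; apply: filterS (near_chart_dom ip jp) => x [_ jx] /=.
by rewrite chartK.
Qed.

Lemma transition_chart i j p : chart_dom i p -> transition i j (chart i p) = chart j p.
Proof. by move=> ip; rewrite /transition /= chartK. Qed.

(** The chain rule for the cocycle identity of the transition maps. *)
Lemma transition_cocycle i j k p w :
  chart_dom i p -> chart_dom j p -> chart_dom k p ->
  'D_('D_w (transition i j) (chart i p)) (transition j k) (chart j p) =
  'D_w (transition i k) (chart i p).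
Proof.
move=> ip jp kp; rewrite -(transition_chart j ip).
rewrite -derive_chain; [|exact: transition_diff|].
  apply: near_eq_derive; exact: (near_transition_comp (chart k)).
by rewrite transition_chart//; exact: transition_diff.
Qed.

Lemma transition_id i p w : chart_dom i p ->
  'D_w (transition i i) (chart i p) = w.
Proof.
move=> ip; rewrite -[RHS](derive_id (chart i p) w); apply: near_eq_derive.
apply: filterS (near_chart_dom ip ip) => x [ix _].
by have [_] := chart_imgP ix.
Qed.

Lemma tcoordE c p w : tcoord c p w =
  'D_w (transition (chart_at p) c) (chart (chart_at p) p).
Proof. by []. Qed.

Lemma tvecE c x y : chart_img c x -> tvec c (x, y) =
  (chart_inv c x, 'D_y (transition c (chart_at (chart_inv c x))) (chart c (chart_inv c x))).
Proof. by move=> cx; have [_ E] := chart_imgP cx; rewrite E. Qed.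

Lemma tvec_chart c p y : chart_dom c p ->
  tvec c (chart c p, y) = (p, 'D_y (transition c (chart_at p)) (chart c p)).
Proof. by move=> cp; rewrite tvecE ?chartK//; exact: chart_img_chart. Qed.

Lemma tcoordK c p w : chart_dom c p -> tvec c (chart c p, tcoord c p w) = (p, w).
Proof.
move=> cp; rewrite tvec_chart// tcoordE.
by rewrite (transition_cocycle _ (mem_chart_at p) cp (mem_chart_at p)) transition_id//; exact: mem_chart_at.
Qed.

Lemma tcoord_linear c p : chart_dom c p -> linear (tcoord c p).
Proof.
move=> cp a u w; have dt := transition_diff (mem_chart_at p) cp.
by rewrite !tcoordE deriveDl// deriveZl.
Qed.

Lemma tvec_linear c p : chart_dom c p -> linear (fun y => (tvec c (chart c p, y)).2).
Proof.
move=> cp a u w; have dt := transition_diff cp (mem_chart_at p).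
by rewrite !tvec_chart//= deriveDl// deriveZl.
Qed.

(** Such a field is a smooth field on the domain of [c] only; it is written as
    a combination of coordinate fields so that a connection can be expanded on
    it by linearity. *)
Definition const_field c y p : 'rV[R]_n := \sum_i y 0 i *: coord_field c i p.

Lemma const_fieldE c y p : chart_dom c p ->
  const_field c y p = (tvec c (chart c p, y)).2.
Proof.
move=> cp.
pose gM := GRing.isLinear.Build _ _ _ _ _ (tvec_linear cp).
pose gL : {linear 'rV[R]_n -> 'rV[R]_n} := HB.pack (fun y => (tvec c (chart c p, y)).2) gM.
rewrite [in RHS](row_sum_delta y) -[RHS]/(gL _) linear_sum.
by apply: eq_bigr => i _; rewrite linearZ.
Qed.

Lemma const_field_tvec c y p : chart_dom c p ->
  (p, const_field c y p) = tvec c (chart c p, y).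
Proof. by move=> cp; rewrite const_fieldE// tvec_chart. Qed.

Lemma const_field_delta c (l : 'I_n) : const_field c (delta_mx 0 l) = coord_field c l.
Proof.
apply/funext => p; rewrite /const_field (bigD1 l)//= big1 ?addr0.
  by rewrite mxE !eqxx scale1r.
by move=> m ml; rewrite mxE eqxx/= (negbTE ml) scale0r.
Qed.

Lemma tcoord_const_field c i y p : chart_dom c p -> chart_dom i p ->
  tcoord i p (const_field c y p) = 'D_y (transition c i) (chart c p).
Proof.
move=> cp ip; rewrite (const_fieldE y cp) (tvec_chart y cp) /= tcoordE.
exact: (transition_cocycle y cp (mem_chart_at p) ip).
Qed.

Lemma tcoord_const_field_id c y p : chart_dom c p ->
  tcoord c p (const_field c y p) = y.
Proof. by move=> cp; rewrite tcoord_const_field// transition_id. Qed.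

Lemma vector_field_const c y (Omega : set M) : open Omega ->
  Omega `<=` chart_dom c -> vector_field Omega (const_field c y).
Proof.
move=> oO Oc i.
have oP := open_chart_preimage (i := i) oO.
have oQ := open_chart_preimage (i := c) (@open_chart_dom _ _ M i).
have oT := open_chart_preimage (i := i) (@open_chart_dom _ _ M c).
apply/smooth_onP => // k.
have sT : Cinf [set x | chart_img i x /\ chart_dom c (chart_inv i x)] (transition i c).
  by apply/smooth_onP => //; exact: smooth_transition.
have sD : Cinf [set x | chart_img c x /\ chart_dom i (chart_inv c x)] ('D_y (transition c i)).
  apply/smooth_onP => //; apply: smooth_on_derive; exact: smooth_transition.
have h := Cinf_comp (rV_frame n) (f := transition i c) _ sD sT.
apply: (Ck_subset _ _ (h _ k)).
- by move=> x [ix /Oc cx].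
- move=> x [ix /Oc cx] /=.
  by rewrite /field_rep tcoord_const_field//; have [] := chart_imgP ix.
- move=> x [ix cx] /=; rewrite /transition /= chartK//; split.
    exact: chart_img_chart.
  by have [] := chart_imgP ix.
Qed.

(** [field_deriv] is computed in the preferred chart at [p]; the chain rule
    through the transition map moves it to the chart [c]. *)
Lemma field_deriv_const c y f p : chart_dom c p ->
  differentiable (f \o chart_inv c) (chart c p) ->
  field_deriv (const_field c y) f p = 'D_y (f \o chart_inv c) (chart c p).
Proof.
move=> cp df; rewrite /field_deriv; have c0p := mem_chart_at p.
have dt := transition_diff c0p cp.
rewrite -(near_eq_derive _ (near_transition_comp f c0p cp)).
have df' : differentiable (f \o chart_inv c) (transition (chart_at p) c (chart (chart_at p) p)).
  by rewrite (transition_chart c c0p).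
have dir : 'D_(const_field c y p) (transition (chart_at p) c) (chart (chart_at p) p) = y.
  exact: tcoord_const_field_id.
by rewrite (derive_chain _ dt df') dir (transition_chart c c0p).
Qed.

Lemma field_deriv_cst (X : M -> 'rV[R]_n) (a : R) p : field_deriv X (fun=> a) p = 0.
Proof. exact: derive_cst. Qed.

(** In the preferred chart at [p] the bracket is the antisymmetrization of the
    second derivative of the transition map from [c], which is symmetric. *)
Lemma lie_bracket_const c u w p : chart_dom c p ->
  lie_bracket (const_field c u) (const_field c w) p = 0.
Proof.
move=> cp; rewrite /lie_bracket; set c0 := chart_at p.
have c0p : chart_dom c0 p := mem_chart_at p.
have sD y : smooth_on [set x | chart_img c x /\ chart_dom c0 (chart_inv c x)]
   ('D_y (transition c c0)).
  apply: smooth_on_derive; exact: smooth_transition.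
have cx : [set x | chart_img c x /\ chart_dom c0 (chart_inv c x)] (chart c p).
  by split; [exact: chart_img_chart|rewrite chartK].
have key a b : 'D_(const_field c a p) (field_rep c0 (const_field c b)) (chart c0 p)
   = 'D_a ('D_b (transition c c0)) (chart c p).
  have -> : 'D_(const_field c a p) (field_rep c0 (const_field c b)) (chart c0 p) =
      'D_(const_field c a p) ('D_b (transition c c0) \o transition c0 c) (chart c0 p).
    apply: near_eq_derive; apply: filterS (near_chart_dom c0p cp) => x [c0x cx'].
    by rewrite /field_rep tcoord_const_field//; have [] := chart_imgP c0x.
  have dt := transition_diff c0p cp.
  have dD : differentiable ('D_b (transition c c0)) (transition c0 c (chart c0 p)).
    by rewrite (transition_chart c c0p); exact: (smooth_on_diff (sD b)).
  have dir : 'D_(const_field c a p) (transition c0 c) (chart c0 p) = a.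
    exact: tcoord_const_field_id.
  by rewrite (derive_chain _ dt dD) dir (transition_chart c c0p).
have oO : open [set x | chart_img c x /\ chart_dom c0 (chart_inv c x)].
  exact/open_chart_preimage/open_chart_dom.
have sT : smooth_on [set x | chart_img c x /\ chart_dom c0 (chart_inv c x)]
    (transition c c0) by exact: smooth_transition.
have E := derive_swap w u oO cx sT.
by rewrite (key u w) (key w u); apply/eqP; rewrite subr_eq0; apply/eqP; exact: E.
Qed.

End Charts.

(** * The fundamental and Cartan tensors in a chart *)

Section LocalMetric.
Context {R : realType} {n : nat} {M : smooth_manifold R n}.
Implicit Types (p : M) (i j k c : chart_index M) (x y z u w : 'rV[R]_n).

Lemma const_field_linear c p : linear (const_field c ^~ p).
Proof.
move=> a u w; rewrite /const_field scaler_sumr -big_split; apply: eq_bigr => l _ /=.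
by rewrite !mxE scalerDl scalerA.
Qed.

Lemma const_field0 c p : const_field c 0 p = 0.
Proof. by rewrite /const_field big1// => l _; rewrite mxE scale0r. Qed.

Lemma const_fieldD c u w p : const_field c (u + w) p = const_field c u p + const_field c w p.
Proof. by have := const_field_linear c p 1 u w; rewrite !scale1r. Qed.

Lemma const_fieldZ c (a : R) u p : const_field c (a *: u) p = a *: const_field c u p.
Proof. by have := const_field_linear c p a u 0; rewrite const_field0 !addr0. Qed.

Lemma const_field_tcoord c p w : chart_dom c p -> const_field c (tcoord c p w) p = w.
Proof. by move=> cp; rewrite (const_fieldE _ cp) (tcoordK _ cp). Qed.

(** The domain of a metric and the metric itself as functions of the
    coordinates (x, y) that the chart [c] induces on the tangent bundle. *)
Definition local_dom c (A : set (TM M)) : set ('rV[R]_n * 'rV[R]_n) :=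
  [set xy | chart_img c xy.1 /\ A (tvec c xy)].

Definition local_rep c (f : TM M -> R) (xy : 'rV[R]_n * 'rV[R]_n) : R :=
  f (tvec c xy).

Lemma local_domP c A p y : chart_dom c p ->
  local_dom c A (chart c p, y) <-> A (p, const_field c y p).
Proof.
move=> cp; rewrite (const_field_tvec y cp); split=> [[]//|h].
by split=> //; exact: chart_img_chart.
Qed.

Lemma local_repE c f p y : chart_dom c p ->
  local_rep c f (chart c p, y) = f (p, const_field c y p).
Proof. by move=> cp; rewrite (const_field_tvec y cp). Qed.

(** Tangent vectors enter through their components in [c], and these depend
    linearly on the vector, so the tensor is a second derivative along the
    fibre. *)
Lemma fundamental_tensor_local c (L : TM M -> R) p y u w : chart_dom c p ->
  fundamental_tensor L (p, const_field c y p) (const_field c u p) (const_field c w p)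
  = 2^-1 * 'D_(0, u) ('D_(0, w) (local_rep c L)) (chart c p, y).
Proof.
move=> cp; apply: (congr1 ( *%R 2^-1)).
apply: derive1_lineE => t; apply: derive1_lineE => s /=.
rewrite -!const_fieldZ -!const_fieldD -(local_repE L _ cp).
by congr (local_rep _ _ (_, _)); rewrite /= !scaler0 !addr0.
Qed.

Lemma cartan_tensor_local c (L : TM M -> R) p y u w z : chart_dom c p ->
  cartan_tensor L (p, const_field c y p)
    (const_field c u p) (const_field c w p) (const_field c z p)
  = 4^-1 * 'D_(0, z) ('D_(0, w) ('D_(0, u) (local_rep c L))) (chart c p, y).
Proof.
move=> cp; apply: (congr1 ( *%R 4^-1)).
apply: derive1_lineE => t; apply: derive1_lineE => s; apply: derive1_lineE => r /=.
rewrite -!const_fieldZ -!const_fieldD -(local_repE L _ cp).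
congr (local_rep _ _ (_, _)); first by rewrite /= !scaler0 !addr0.
by rewrite /= -!addrA; congr (_ + _); rewrite addrA addrC; congr (_ + _); rewrite addrC.
Qed.

Section Conic.
Variables (A : set (TM M)) (c : chart_index M).
Hypothesis hA : conic_domain A.

Lemma local_dom_open : open (local_dom c A).
Proof. exact: (conic_open hA). Qed.

Lemma local_dom_conic x y (a : R) : local_dom c A (x, y) -> 0 < a ->
  local_dom c A (x, a *: y).
Proof.
move=> [/= cx Axy] a0; have [cp E] := chart_imgP cx.
have := conic_scale hA Axy a0; rewrite -E -!const_field_tvec//.
rewrite /tscale /= -const_fieldZ const_field_tvec// => h.
by split => //=; rewrite E.
Qed.

Lemma local_rep_homogeneous (f : TM M -> R) (k : nat) :
  (forall v (a : R), A v -> 0 < a -> f (tscale a v) = a ^+ k * f v) ->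
  fibre_homogeneous (local_dom c A) k (local_rep c f).
Proof.
move=> hf x y a [/= cx Axy] a0; rewrite -hf//.
have [cp E] := chart_imgP cx.
rewrite /local_rep -E -!const_field_tvec//.
by rewrite /tscale /= -const_fieldZ.
Qed.

End Conic.
End LocalMetric.

(** * The spray of the Chern connection *)

Section Partial.
Context {R : realType} {X Y W : normedModType R}.
Lemma derive_fst (G : X * Y -> W) (x u : X) (y : Y) :
  'D_u (fun x' => G (x', y)) x = 'D_(u, 0) G (x, y).
Proof.
rewrite -derive1_line; apply: derive1_lineE => s.
by congr (G (_, _)) => /=; rewrite ?scaler0 ?addr0.
Qed.

Lemma differentiable_fst (G : X * Y -> W) (x : X) (y : Y) :
  differentiable G (x, y) -> differentiable (fun x' => G (x', y)) x.
Proof.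
move=> dG; have di : differentiable (fun x' : X => (x', y)) x.
  by apply: differentiable_pair => //; exact: differentiable_cst.
exact: (differentiable_comp di dG).
Qed.
End Partial.

(** The linear combination of the two metric identities that [chern_spray]
    needs, with [k1], [k2] the Cartan terms and [h1], [h2] the terms that Euler's
    identity evaluates. *)
Lemma spray_arith (R : realType) (a b d g k1 k2 h1 h2 : R) :
  k1 = 0 -> k2 = 0 -> h1 = d -> h2 = d ->
  2^-1 * a = 2^-1 * g + 2^-1 * h1 + 2 * (4^-1 * k1) ->
  b = 2^-1 * h2 + 2^-1 * h1 + 2 * (4^-1 * k2) -> g = a - b.
Proof. by move=> -> -> -> ->; lra. Qed.

Section Chern.
Context {R : realType} {n : nat} {M : smooth_manifold R n}.
Variables (A : set (TM M)) (L : TM M -> R).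
Variable (nabla : TM M -> (M -> 'rV[R]_n) -> (M -> 'rV[R]_n) -> 'rV[R]_n).
Hypotheses (hA : conic_domain A) (hL : pseudo_finsler A L).
Hypothesis (hN : chern_connection A L nabla).
Variables (c : chart_index M).
Implicit Types (p : M) (x y z u w : 'rV[R]_n).

Local Notation F := (local_rep c L).
Local Notation D := (local_dom c A).

Lemma finsler_local_smooth : smooth_on D F.
Proof. exact: (finsler_smooth hL c). Qed.

Lemma finsler_local_hom : fibre_homogeneous D 2 F.
Proof. by apply: local_rep_homogeneous => v a; exact: finsler_homogeneous. Qed.

Lemma finsler_diff q : D q -> differentiable F q.
Proof. by move=> Dq; exact: (smooth_on_diff finsler_local_smooth). Qed.

Lemma finsler_diff1 (v q : 'rV[R]_n * 'rV[R]_n) : D q -> differentiable ('D_v F) q.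
Proof. by move=> Dq; exact: (smooth_on_diff (smooth_on_derive v finsler_local_smooth)). Qed.

Lemma finsler_diff2 (v w q : 'rV[R]_n * 'rV[R]_n) : D q -> differentiable ('D_v ('D_w F)) q.
Proof.
move=> Dq; have s1 := smooth_on_derive w finsler_local_smooth.
exact: (smooth_on_diff (smooth_on_derive v s1)).
Qed.

Lemma finsler_hom1 z : fibre_homogeneous D 1 ('D_(0, z) F).
Proof.
exact: (fibre_derive_homogeneous (@local_dom_open _ _ _ A c hA)
  (@local_dom_conic _ _ _ A c hA) z finsler_local_hom finsler_diff).
Qed.

Lemma finsler_euler x y : D (x, y) -> 'D_(0, y) F (x, y) = 2 * F (x, y).
Proof.
move=> Dxy.
exact: (euler_homogeneous finsler_local_hom finsler_diff Dxy).
Qed.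

Lemma finsler_euler1 z x y : D (x, y) ->
  'D_(0, y) ('D_(0, z) F) (x, y) = 'D_(0, z) F (x, y).
Proof.
move=> Dxy.
have := (euler_homogeneous (@finsler_hom1 z) (@finsler_diff1 _) Dxy).
by rewrite mul1r.
Qed.

(** This is [2 * 'D_(0, w) L - 'D_(0, w) L]; it says that the fundamental tensor
    at [y] pairs [w] with [y] to half of ['D_(0, w) L]. *)
Lemma finsler_derive_euler w x y : D (x, y) ->
  'D_(0, w) ('D_(0, y) F) (x, y) = 'D_(0, w) F (x, y).
Proof.
move=> Dxy.
have := (derive_euler (@local_dom_open _ _ _ A c hA) finsler_local_hom
  finsler_diff Dxy (@finsler_diff1 (0, w) _ Dxy)).
by rewrite mulr_natl mulr2n addrK.
Qed.

(** ['D_(0, u) L] is homogeneous of degree one, for which [derive_euler] gives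
    [1 - 1 = 0]: the Cartan tensor vanishes when its second entry is the
    reference vector. *)
Lemma finsler_cartan_euler u z x y : D (x, y) ->
  'D_(0, z) ('D_(0, y) ('D_(0, u) F)) (x, y) = 0.
Proof.
move=> Dxy.
have := (derive_euler (@local_dom_open _ _ _ A c hA) (@finsler_hom1 u)
  (@finsler_diff1 _) Dxy (@finsler_diff2 (0, z) _ _ Dxy)).
by rewrite mul1r subrr.
Qed.

Lemma admissible_open y : open [set p | chart_dom c p /\ A (p, const_field c y p)].
Proof.
rewrite openE => p [cp Ap]; rewrite /interior.
have n1 : nbhs p (chart_dom c) by apply: open_nbhs_nbhs; split=> //; exact: open_chart_dom.
have n2 : nbhs p [set q | D (chart c q, y)].
  have n3 : nbhs (chart c p) [set x | D (x, y)].
    have cy : {for chart c p, continuous (fun x : 'rV[R]_n => (x, y))}.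
      apply: differentiable_continuous; apply: differentiable_pair => //.
    apply: cy; apply: open_nbhs_nbhs; split; first exact: local_dom_open.
    exact/local_domP.
  exact: (continuous_chart cp n3).
apply: filterS2 n1 n2 => q cq /(local_domP _ _ cq); by split.
Qed.

(** The components [y] of the reference field are constant, so a derivative
    along the base in the direction [z] is ['D_(z, 0)] at fixed [y]. *)
Lemma field_deriv_fundamental p y u w z (G : 'rV[R]_n * 'rV[R]_n -> R) :
  chart_dom c p -> A (p, const_field c y p) ->
  (forall q, D q -> differentiable G q) ->
  (forall x, D (x, y) -> 2^-1 * 'D_(0, u) ('D_(0, w) F) (x, y) = G (x, y)) ->
  field_deriv (const_field c z)
    (fun q => fundamental_tensor L (q, const_field c y q) (const_field c u q) (const_field c w q)) p =
  'D_(z, 0) G (chart c p, y).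
Proof.
move=> cp Ap dG GE.
have Dp : D (chart c p, y) by exact/local_domP.
pose f := fun q => fundamental_tensor L (q, const_field c y q) (const_field c u q) (const_field c w q).
have nO : \forall x \near chart c p, G (x, y) = (f \o chart_inv c) x.
  have nO : nbhs p [set p | chart_dom c p /\ A (p, const_field c y p)].
    by apply: open_nbhs_nbhs; split => //; exact: admissible_open.
  apply: filterS (near_chart_inv cp nO) => x [cx [cp' Ap']].
  rewrite /f /= (fundamental_tensor_local _ _ _ _ cp').
  have [_ E] := chart_imgP cx.
  rewrite E GE//; rewrite -E; exact/local_domP.
have dGx : differentiable (fun x => G (x, y)) (chart c p) by apply/differentiable_fst/dG.
have df : differentiable (f \o chart_inv c) (chart c p).
  by have [] := is_diff_near nO (differentiableP dGx).
rewrite (field_deriv_const z cp df) -(near_eq_derive _ nO).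
exact: derive_fst.
Qed.

(** Let [V] and [Z] be the fields with constant components [y] and [z], and take
    [V] as reference. The metric identities for (V; V, Z) and for (Z; V, V)
    contain no Cartan term by homogeneity, and by Euler's identity
    [g_V(V, w)] is half of ['D_(0, w) L]. Since [V] and [Z] commute, the torsion
    identity equates the derivatives of [V] along [Z] and of [Z] along [V];
    this term is eliminated between the two identities. *)
Lemma chern_spray p y z : chart_dom c p -> A (p, const_field c y p) ->
  'D_(0, tcoord c p (nabla (p, const_field c y p) (const_field c y) (const_field c y)))
    ('D_(0, z) F) (chart c p, y) =
  'D_(y, 0) ('D_(0, z) F) (chart c p, y) - 'D_(z, 0) F (chart c p, y).
Proof.
move=> cp Ap; set V := const_field c y; set G := tcoord c p _.
have Dp : D (chart c p, y) by exact/local_domP.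
pose Omega := [set q | chart_dom c q /\ A (q, const_field c y q)].
have oO : open Omega by exact: admissible_open.
have Oc : Omega `<=` chart_dom c by move=> q [].
have Op : Omega p by [].
have vf u : vector_field Omega (const_field c u) by exact: vector_field_const.
have aV : admissible_field A Omega V by split; [exact: vf|move=> q [_ Aq]; exact: Aq].
have cf w : const_field c (tcoord c p w) p = w by exact: const_field_tcoord.
have t := chern_torsion_free hN oO aV (vf y) (vf z) Op.
rewrite (lie_bracket_const y z cp) in t.
have {t} HE : nabla (p, V p) (const_field c z) V = nabla (p, V p) V (const_field c z).
  by apply/esym/eqP; rewrite -subr_eq0; apply/eqP.
pose H := tcoord c p (nabla (p, V p) V (const_field c z)).
have E1 := chern_almost_metric hN oO aV (vf y) (vf y) (vf z) Op.
have E2 := chern_almost_metric hN oO aV (vf z) (vf y) (vf y) Op.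
have dg w q : D q -> differentiable (2^-1 \*: 'D_(0, w) F) q.
  by move=> Dq; apply: differentiableZ; exact: finsler_diff1.
rewrite (field_deriv_fundamental y cp Ap (dg z)) in E1; last first.
  by move=> x Dx; rewrite finsler_euler1.
rewrite (field_deriv_fundamental z cp Ap (@finsler_diff)) in E2; last first.
  move=> x Dx; rewrite (finsler_euler1 _ Dx) (finsler_euler Dx).
  have two : 2 != 0 :> R by rewrite pnatr_eq0.
  exact: mulKf two _.
rewrite deriveZ in E1; last by apply: diff_derivable; exact: finsler_diff1.
rewrite HE -[nabla _ _ _]cf -/H in E2.
rewrite -[nabla _ _ V]cf -[nabla _ _ (const_field c z)]cf -/H -/V -/G in E1.
rewrite !(fundamental_tensor_local L _ _ _ cp) (cartan_tensor_local L _ _ _ _ cp) in E1.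
rewrite !(fundamental_tensor_local L _ _ _ cp) (cartan_tensor_local L _ _ _ _ cp) in E2.
exact: (spray_arith (finsler_cartan_euler G z Dp) (finsler_cartan_euler H y Dp)
  (finsler_euler1 H Dp) (finsler_derive_euler H Dp) E1 E2).
Qed.
End Chern.

(** * Christoffel symbols and nondegeneracy in a chart *)

Section Nabla.
Context {R : realType} {n : nat} {M : smooth_manifold R n}.
Variables (A : set (TM M)).
Variable (nabla : TM M -> (M -> 'rV[R]_n) -> (M -> 'rV[R]_n) -> 'rV[R]_n).
Hypothesis (hN : anisotropic_connection A nabla).
Variables (c : chart_index M).
Implicit Types (p : M) (x y z u w : 'rV[R]_n) (v : TM M).

Lemma fsmooth_cst (Omega : set M) (a : R) : open Omega -> fsmooth_on Omega (fun=> a).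
Proof.
move=> oO i; apply/smooth_onP; first exact: open_chart_preimage.
by move=> k; exact: Ck_cst.
Qed.

Let oc : open (@chart_dom _ _ M c) := @open_chart_dom _ _ M c.

Let vf u : vector_field (chart_dom c) (const_field c u).
Proof. exact: vector_field_const. Qed.

Lemma nabla_const_linearl v w : A v -> chart_dom c v.1 ->
  linear (fun u => nabla v (const_field c u) (const_field c w)).
Proof.
move=> Av cv a u u'.
have -> : const_field c (a *: u + u') = fun q => const_field c (a *: u) q + const_field c u' q.
  by apply/funext => q; exact: const_fieldD.
rewrite (nabla_addl hN oc (vf _) (vf _) (vf _) Av cv); congr (_ + _).
have -> : const_field c (a *: u) = fun q => a *: const_field c u q.
  by apply/funext => q; exact: const_fieldZ.
exact: (nabla_scalel hN oc (vf u) (vf w) (fsmooth_cst a oc) Av cv).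
Qed.

Lemma nabla_const_linearr v u : A v -> chart_dom c v.1 ->
  linear (fun w => nabla v (const_field c u) (const_field c w)).
Proof.
move=> Av cv a w w'.
have -> : const_field c (a *: w + w') = fun q => const_field c (a *: w) q + const_field c w' q.
  by apply/funext => q; exact: const_fieldD.
rewrite (nabla_addr hN oc (vf _) (vf _) (vf _) Av cv); congr (_ + _).
have -> : const_field c (a *: w) = fun q => a *: const_field c w q.
  by apply/funext => q; exact: const_fieldZ.
rewrite (nabla_leibniz hN oc (vf u) (vf w) (fsmooth_cst a oc) Av cv).
by rewrite field_deriv_cst scale0r add0r.
Qed.

Lemma linear_row_sum (V : lmodType R) (f : 'rV[R]_n -> V) u : linear f ->
  f u = \sum_i u 0 i *: f (delta_mx 0 i).
Proof.
move=> lin; pose gM := GRing.isLinear.Build _ _ _ _ _ lin.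
pose g : {linear 'rV[R]_n -> V} := HB.pack f gM.
rewrite [in LHS](row_sum_delta u) -[LHS]/(g _) linear_sum.
by apply: eq_bigr => i _; rewrite linearZ.
Qed.

Lemma tcoord_nabla_const v u w (k : 'I_n) : A v -> chart_dom c v.1 ->
  tcoord c v.1 (nabla v (const_field c u) (const_field c w)) 0 k =
  \sum_i \sum_j u 0 i * w 0 j * christoffel nabla c k i j v.
Proof.
move=> Av cv.
pose N u w := tcoord c v.1 (nabla v (const_field c u) (const_field c w)).
have Nl w' : linear (N^~ w').
  by move=> a b d; rewrite /N nabla_const_linearl// (tcoord_linear cv).
have Nr u' : linear (N u').
  by move=> a b d; rewrite /N nabla_const_linearr// (tcoord_linear cv).
rewrite -/(N u w) (linear_row_sum _ (Nl w)) summxE; apply: eq_bigr => i _.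
rewrite (linear_row_sum _ (Nr _)) mxE summxE mulr_sumr; apply: eq_bigr => j _.
by rewrite mxE mulrA /N !const_field_delta.
Qed.

Lemma tcoord0 p : chart_dom c p -> tcoord c p 0 = 0.
Proof.
move=> cp; have := tcoord_linear cp (-1) 0 0.
by rewrite scaler0 addr0 scaleN1r addNr.
Qed.

Lemma const_field_eq0 p u : chart_dom c p -> const_field c u p = 0 -> u = 0.
Proof.
move=> cp cu0; rewrite -(tcoord_const_field_id u cp) cu0.
exact: tcoord0.
Qed.
(** Every tangent vector at [p] has components in [c], so testing against all
    [z] is testing against all tangent vectors. *)
Lemma nondegenerate_local (L : TM M -> R) p y u : pseudo_finsler A L ->
  chart_dom c p -> A (p, const_field c y p) ->
  (forall z, 'D_(0, u) ('D_(0, z) (local_rep c L)) (chart c p, y) = 0) -> u = 0.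
Proof.
move=> hL cp Ap h; apply: (const_field_eq0 cp).
apply: (finsler_nondegenerate hL Ap) => w.
rewrite -(const_field_tcoord w cp) (fundamental_tensor_local L _ _ _ cp) h.
exact: mulr0.
Qed.
End Nabla.

(** * Geodesics as solutions of the Euler-Lagrange equations *)

Lemma spray_split (V : zmodType) (x a b : V) : x + a = b + (a + (x - b)).
Proof. by rewrite [RHS]addrC -!addrA addNr addr0 addrC. Qed.

Lemma chart_time_rel_open (R : realType) (n : nat) (M : smooth_manifold R n)
    (D : set R) (gamma : R -> M) (c : chart_index M) :
  {within D, continuous gamma} ->
  rel_open [set t | D t /\ chart_dom c (gamma t)] D.
Proof.
move=> gC; split=> [t []//|t [Dt ct]].
have /subspace_continuousP/(_ _ Dt) gc := gC.
have : nbhs (gamma t) (chart_dom c).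
  by apply: open_nbhs_nbhs; split=> //; exact: open_chart_dom.
move=> /gc; rewrite /nbhs /= => h.
have {}h : \forall s \near t, D s -> chart_dom c (gamma s) by exact: h.
by apply: filterS h => s h Ds; split => //; exact: h.
Qed.

Section Curves.
Context {R : realType} {n : nat} {M : smooth_manifold R n}.
Variables (D : set R) (gamma : R -> M).
Hypothesis lD : D `<=` limit_point D.
Hypothesis hg : smooth_curve D gamma.
Implicit Types (c i : chart_index M) (t : R).

Definition chart_time c : set R := [set t | D t /\ chart_dom c (gamma t)].

Let chart_time_rel_open c : rel_open (chart_time c) D.
Proof. exact: chart_time_rel_open hg.1. Qed.

Lemma chart_time_limit_point c : chart_time c `<=` limit_point (chart_time c).
Proof. exact: rel_open_limit_point (chart_time_rel_open c) lD. Qed.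

Lemma chart_curve_smooth c : Cinf (chart_time c) (chart c \o gamma).
Proof. exact/(smooth_withinP _ (@chart_time_limit_point c))/hg.2. Qed.

Definition chart_velocity c t : 'rV[R]_n := derive_within D (chart c \o gamma) t.

Lemma derive_within_rel_open (W : normedModType R) (E : set R) (f df : R -> W) t :
  rel_open E D -> E t -> is_diff_in E t f df ->
  [/\ is_diff_in D t f df, derivable_within D f t & derive_within D f t = df 1].
Proof.
move=> oE Et fd; have fd' := rel_open_is_diff_in oE Et fd.
have Dt := oE.1 _ Et.
by have [? ?] := derive_within_val Dt (lD Dt) fd'.
Qed.

Lemma chart_velocity_smooth c : Cinf (chart_time c) (chart_velocity c).
Proof.
move=> k; have [df dfP dfC] := chart_curve_smooth c k.+1.
apply: Ck_eq (dfC 1) => t ct.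
by have [_ _ <-] := derive_within_rel_open (chart_time_rel_open c) ct (dfP _ ct).
Qed.

Lemma chart_curve_diff c t : chart_time c t ->
  is_diff_in (chart_time c) t (chart c \o gamma) (fun h => h *: chart_velocity c t).
Proof.
move=> ct; have [df dfP _] := chart_curve_smooth c 1%N.
have fd := dfP _ ct; have [_ _ E] := derive_within_rel_open (chart_time_rel_open c) ct fd.
by rewrite /chart_velocity E -(is_diff_in_derive1 fd).
Qed.

(** The velocity is computed in the preferred chart at [gamma t]; the curve in
    [c] is its image under a transition map, which is differentiable. *)
Lemma tcoord_velocity c t : chart_time c t ->
  tcoord c (gamma t) (velocity D gamma t) = chart_velocity c t.
Proof.
move=> ct; have [Dt cg] := ct.
set c0 := chart_at (gamma t).
have c0g : chart_dom c0 (gamma t) := mem_chart_at (gamma t).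
have c0t : chart_time c0 t by [].
have d0 := chart_curve_diff c0t.
have dT := transition_diff c0g cg.
have d1 := is_diff_in_comp c0t (fun _ _ => I) d0 (is_diff_in_is_diff setT (differentiableP dT)).
have oE := chart_time_rel_open c0.
have d2 : is_diff_in (chart_time c0) t (chart c \o gamma)
    ('d (transition c0 c) (chart c0 (gamma t)) \o (fun h => h *: chart_velocity c0 t)).
  apply: is_diff_in_subset d1 => // s [_ c0s] /=.
  exact: transition_chart.
have [_ _ E] := derive_within_rel_open oE c0t d2.
rewrite /chart_velocity E /= scale1r tcoordE.
exact: deriveE.
Qed.

Lemma const_field_velocity c t : chart_time c t ->
  const_field c (chart_velocity c t) (gamma t) = velocity D gamma t.
Proof. by move=> ct; rewrite -tcoord_velocity// const_field_tcoord//; case: ct. Qed.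

Definition curve_lift c t : 'rV[R]_n * 'rV[R]_n := (chart c (gamma t), chart_velocity c t).

Lemma curve_lift_smooth c : Cinf (chart_time c) (curve_lift c).
Proof.
by move=> k; apply: Ck_pair; [exact: chart_curve_smooth|exact: chart_velocity_smooth].
Qed.

Definition chart_acceleration c t : 'rV[R]_n := derive_within D (chart_velocity c) t.

Lemma chart_velocity_diff c t : chart_time c t ->
  is_diff_in (chart_time c) t (chart_velocity c) (fun h => h *: chart_acceleration c t).
Proof.
move=> ct; have [df dfP _] := chart_velocity_smooth c 1%N.
have fd := dfP _ ct; have [_ _ E] := derive_within_rel_open (chart_time_rel_open c) ct fd.
by rewrite /chart_acceleration E -(is_diff_in_derive1 fd).
Qed.

Lemma curve_lift_diff c t : chart_time c t ->
  is_diff_in (chart_time c) t (curve_lift c)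
    (fun h => h *: (chart_velocity c t, chart_acceleration c t)).
Proof.
move=> ct; have [g gf gd] := chart_curve_diff ct; have [g' gf' gd'] := chart_velocity_diff ct.
exists (fun s => (g s, g' s)); last exact: is_diff_pair.
by move=> s cs; rewrite gf// gf'.
Qed.

(** The Christoffel sum is bilinear in the velocity, hence it is the covariant
    derivative of the field that extends the velocity with constant
    components. *)
Lemma covariant_derivativeE nabla c t (A : set (TM M)) : anisotropic_connection A nabla ->
  chart_time c t -> A (gamma t, velocity D gamma t) ->
  covariant_derivative nabla D gamma (velocity D gamma) (velocity D gamma) c t =
  const_field c (chart_acceleration c t +
    tcoord c (gamma t) (nabla (gamma t, velocity D gamma t)
      (const_field c (chart_velocity c t)) (const_field c (chart_velocity c t)))) (gamma t).
Proof.
move=> hN ct At; have [Dt cg] := ct.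
rewrite /covariant_derivative /const_field; apply: eq_bigr => k _; congr (_ *: _).
rewrite mxE (tcoord_velocity ct).
have := tcoord_nabla_const (v := (gamma t, velocity D gamma t)) hN
  (chart_velocity c t) (chart_velocity c t) k At cg.
rewrite /= => ->; congr (_ + _).
have cc := @rV_coord_continuous R n k.
have d1 := is_diff_in_comp ct (fun _ _ => I) (chart_velocity_diff ct)
  (is_diff_in_is_diff setT (is_diff_linear_fun (chart_velocity c t) cc)).
have d2 : is_diff_in (chart_time c) t
   (fun s => tcoord c (gamma s) (velocity D gamma s) 0 k)
   (rV_coord k \o (fun h => h *: chart_acceleration c t)).
  by apply: is_diff_in_subset d1 => // s cs /=; rewrite tcoord_velocity.
have [_ _ ->] := derive_within_rel_open (chart_time_rel_open c) ct d2.
by rewrite /= scale1r.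
Qed.

(** By the chain rule, the derivative of ['D_(0, z) L] along the lift is
    ['D_(x', 0) 'D_(0, z) L + 'D_(0, x'') 'D_(0, z) L]. With [chern_spray] it differs
    from ['D_(z, 0) L] by the fundamental tensor applied to the covariant
    acceleration and [z], up to a factor of two, and nondegeneracy concludes. *)
Lemma geodesic_euler_lagrange (A : set (TM M)) L nabla c t :
  conic_domain A -> pseudo_finsler A L -> chern_connection A L nabla ->
  chart_time c t -> A (gamma t, velocity D gamma t) ->
  covariant_derivative nabla D gamma (velocity D gamma) (velocity D gamma) c t = 0 <->
  forall z : 'rV[R]_n,
    is_diff_in D t (fun s => 'D_(0, z) (local_rep c L) (curve_lift c s))
      (fun h => h *: 'D_(z, 0) (local_rep c L) (curve_lift c t)).
Proof.
move=> hA hL hN ct At; have [Dt cg] := ct.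
rewrite (covariant_derivativeE (chern_anisotropic hN) ct At).
move: At; rewrite -(const_field_velocity ct) => At.
set y := chart_velocity c t in At *.
set G := tcoord c (gamma t) _.
set a := chart_acceleration c t.
have Dp : local_dom c A (chart c (gamma t), y) by exact/local_domP.
have dz z : differentiable ('D_(0, z) (local_rep c L)) (chart c (gamma t), y).
  exact: (finsler_diff1 hL).
have split z : 'D_(y, a) ('D_(0, z) (local_rep c L)) (curve_lift c t) =
   'D_(z, 0) (local_rep c L) (curve_lift c t) +
   'D_(0, a + G) ('D_(0, z) (local_rep c L)) (curve_lift c t).
  have E1 : (y, a) = (y, 0) + (0, a) :> 'rV[R]_n * 'rV[R]_n.
    by congr pair; rewrite /= ?addr0 ?add0r.
  have E2 : (0, a + G) = (0, a) + (0, G) :> 'rV[R]_n * 'rV[R]_n.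
    by congr pair; rewrite /= ?addr0.
  rewrite E1 E2 (deriveDl _ _ (dz z)) (deriveDl _ _ (dz z)).
  have := chern_spray hA hL hN z cg At; rewrite -/G => ->.
  exact: spray_split.
have chain z : is_diff_in D t (fun s => 'D_(0, z) (local_rep c L) (curve_lift c s))
    (fun h => h *: 'D_(y, a) ('D_(0, z) (local_rep c L)) (curve_lift c t)).
  apply: (rel_open_is_diff_in (chart_time_rel_open c) ct).
  have ch := is_diff_in_comp ct (fun _ _ => I) (curve_lift_diff ct)
    (is_diff_in_is_diff setT (differentiableP (dz z))).
  have ch' := ch; rewrite (is_diff_in_derive1 ch) in ch'.
  have e : ('d ('D_(0, z) (local_rep c L)) (curve_lift c t) \o
      (fun h : R => h *: (y, a))) 1 =
      'D_(y, a) ('D_(0, z) (local_rep c L)) (curve_lift c t).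
    by rewrite /= scale1r; exact/esym/deriveE.
  by rewrite -e; exact: ch'.
split=> [/(const_field_eq0 cg) aG0 z|EL].
  by have := chain z; rewrite split aG0 derive0 addr0.
rewrite [X in const_field c X](_ : _ = 0) ?const_field0//.
apply: (nondegenerate_local hL cg At) => z.
have [_ e1] := derive_within_val Dt (lD Dt) (chain z).
have [_ e2] := derive_within_val Dt (lD Dt) (EL z).
move: e1; rewrite e2 !scale1r split.
move=> /esym /eqP; rewrite -subr_eq0 addrAC subrr add0r => /eqP.
exact.
Qed.
End Curves.

(** * Change of parameter *)

Section Lift.
Context {R : realType} {n : nat} {M : smooth_manifold R n}.
Variables (A : set (TM M)) (D : set R) (gamma : R -> M).
Hypothesis lD : D `<=` limit_point D.
Hypothesis hg : admissible_curve A D gamma.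
Hypothesis hA : conic_domain A.
Implicit Types (c : chart_index M) (t : R).

Lemma local_rep_lift (f : TM M -> R) c t : chart_time D gamma c t ->
  local_rep c f (curve_lift D gamma c t) = f (gamma t, velocity D gamma t).
Proof.
move=> ct; have [_ cg] := ct.
by rewrite /curve_lift (local_repE f _ cg) (const_field_velocity lD hg.1 ct).
Qed.

Lemma curve_lift_dom c t : chart_time D gamma c t ->
  local_dom c A (curve_lift D gamma c t).
Proof.
move=> ct; have [Dt cg] := ct; apply/(local_domP _ _ cg).
by rewrite (const_field_velocity lD hg.1 ct); exact: hg.2.
Qed.

(** Smoothness is checked on the pieces of [D] that lie over one chart, because
    the velocity is represented in a chart that depends on the point in an
    arbitrary way. *)
Lemma lift_smooth (f : TM M -> R) : tsmooth_on A f ->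
  Cinf D (fun t => f (gamma t, velocity D gamma t)).
Proof.
move=> fs k; apply: Ck_local => // t Dt.
pose c := chart_at (gamma t); exists (chart_time D gamma c); split.
- by split=> //; exact: mem_chart_at.
- exact: chart_time_rel_open hg.1.1.
have sf : Cinf (local_dom c A) (local_rep c f).
  by apply/smooth_onP; [exact: local_dom_open|exact: fs].
have sl := curve_lift_smooth lD hg.1 c.
have := Cinf_comp (pair_frame (rV_frame n) (rV_frame n)) (@curve_lift_dom c) sf sl k.
by apply: Ck_eq => s cs; exact: local_rep_lift.
Qed.
End Lift.

Section Reparametrization.
Context {R : realType} {n : nat} {M : smooth_manifold R n}.
Variables (D D' : set R) (gamma : R -> M) (phi l : R -> R).
Hypotheses (lD : D `<=` limit_point D) (lD' : D' `<=` limit_point D').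
Hypothesis phiD : forall s, D' s -> D (phi s).
Hypothesis phi_diff : forall s, D' s -> is_diff_in D' s phi (fun h => h *: l (phi s)).

(** Bootstrap: the right-hand side of [phi' = l \o phi] is as smooth as [phi],
    so [phi] gains one order of differentiability at each step. *)
Lemma ode_smooth : Cinf D l -> Cinf D' phi.
Proof.
move=> ls; elim=> // k IH; exists (fun v s => v *: l (phi s)) => [s D's|v].
  exact: phi_diff.
by apply: Ck_scalel; exact: (Ck_comp (R_frame (R:=R)) phiD (ls k) IH).
Qed.

Hypothesis hg : smooth_curve D gamma.
Implicit Types (c : chart_index M).

Lemma reparam_continuous : {within D', continuous (gamma \o phi)}.
Proof.
apply/subspace_continuousP => s D's P Pn.
have /subspace_continuousP/(_ _ (phiD D's) _ Pn) gc := hg.1.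
have pc := is_diff_in_continuous D's (phi_diff D's).
have h : \forall u \near s, D' u -> D (phi u) -> P (gamma (phi u)).
  exact: (pc _ gc).
by apply: filterS h => u h D'u; apply: h => //; exact: phiD.
Qed.

Lemma reparam_smooth : Cinf D' phi -> smooth_curve D' (gamma \o phi).
Proof.
move=> ps; split; first exact: reparam_continuous.
move=> c; have oE := chart_time_rel_open c reparam_continuous.
apply/smooth_withinP; first exact: rel_open_limit_point oE lD'.
have gs := chart_curve_smooth lD hg c.
apply: (Cinf_comp (R_frame (R := R)) _ gs).
  by move=> s [D's cs]; split => //; exact: phiD.
by move=> k; apply: Ck_subset (ps k) => // s [].
Qed.

(** The chain rule in the chart [c], with [phi' = l \o phi]. *)
Lemma reparam_chart_velocity c s : smooth_curve D' (gamma \o phi) ->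
  chart_time D' (gamma \o phi) c s ->
  chart_velocity D' (gamma \o phi) c s =
  l (phi s) *: chart_velocity D gamma c (phi s).
Proof.
move=> hg' cs; have [D's cg] := cs.
have ct : chart_time D gamma c (phi s) by split => //; exact: phiD.
have dphi : is_diff_in (chart_time D' (gamma \o phi) c) s phi (fun h => h *: l (phi s)).
  by apply: is_diff_in_subset (phi_diff D's) => // u [].
have sub u : chart_time D' (gamma \o phi) c u -> chart_time D gamma c (phi u).
  by move=> [D'u cu]; split => //; exact: phiD.
have d := is_diff_in_comp cs sub dphi (chart_curve_diff lD hg ct).
have [_ _ E] := derive_within_rel_open lD' (chart_time_rel_open c hg'.1) cs d.
by rewrite /chart_velocity E /= scale1r.
Qed.

Lemma reparam_velocity s : smooth_curve D' (gamma \o phi) -> D' s ->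
  velocity D' (gamma \o phi) s = l (phi s) *: velocity D gamma (phi s).
Proof.
move=> hg' D's; pose c := chart_at (gamma (phi s)).
have cs : chart_time D' (gamma \o phi) c s by split => //; exact: mem_chart_at.
have ct : chart_time D gamma c (phi s) by split; [exact: phiD|exact: mem_chart_at].
rewrite -(const_field_velocity lD' hg' cs) -(const_field_velocity lD hg ct).
by rewrite (reparam_chart_velocity hg' cs) const_fieldZ.
Qed.
End Reparametrization.

(** * Lightlike geodesics of conformal metrics *)

Unset Implicit Arguments.

Theorem proposition3p4 (R : realType) (n : nat) (M : smooth_manifold R n)
    (A : set (TM M)) (L lambda : TM M -> R)
    (nablaL nablalL :
       TM M -> (M -> 'rV[R]_n) -> (M -> 'rV[R]_n) -> 'rV[R]_n)
    (a b a' b' : R) (gamma : R -> M) (phi : R -> R)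
    (hA : conic_domain A)
    (hL : pseudo_finsler A L)
    (lambda_gt0 : forall v, A v -> 0 < lambda v)
    (lambda_smooth : tsmooth_on A lambda)
    (lambda_homogeneous : forall v (c : R), A v -> 0 < c ->
       lambda (tscale c v) = lambda v)
    (hlL : pseudo_finsler A (fun v => lambda v * L v))
    (hnablaL : chern_connection A L nablaL)
    (hnablalL : chern_connection A (fun v => lambda v * L v) nablalL)
    (hab : a < b) (hab' : a' < b')
    (gamma_geodesic : geodesic A nablalL `[a, b] gamma)
    (gamma_lightlike : lightlike (fun v => lambda v * L v) `[a, b] gamma)
    (phi_range : forall mu : R, mu \in `[a', b'] -> phi mu \in `[a, b])
    (phi_ode : forall mu : R, mu \in `[a', b'] ->
       derivable_within `[a', b'] phi mu /\
       derive_within `[a', b'] phi mu =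
         lambda (gamma (phi mu), velocity `[a, b] gamma (phi mu))) :
  geodesic A nablaL `[a', b'] (gamma \o phi) /\
  lightlike L `[a', b'] (gamma \o phi).
Proof.
have lD := itvcc_limit_point hab; have lD' := itvcc_limit_point hab'.
set D := [set` `[a, b]] in lD gamma_geodesic gamma_lightlike phi_ode.
set D' := [set` `[a', b']] in lD' phi_ode.
have phiD s : D' s -> D (phi s) by exact: phi_range.
pose l t := lambda (gamma t, velocity D gamma t).
have phi_diff s : D' s -> is_diff_in D' s phi (fun h => h *: l (phi s)).
  by move=> D's; have [d E] := phi_ode _ D's; rewrite /l -E; exact: derivable_within_diff.
have [hg EL] := gamma_geodesic; have [hgs hgA] := hg.
have phis : Cinf D' phi := ode_smooth phiD phi_diff (lift_smooth lD hg hA lambda_smooth).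
have hgs' : smooth_curve D' (gamma \o phi) := reparam_smooth lD lD' phiD phi_diff hgs phis.
have vel s (D's : D' s) := reparam_velocity lD lD' phiD phi_diff hgs hgs' D's.
have l0 t : D t -> 0 < l t by move=> Dt; apply: lambda_gt0; exact: hgA.
have L0 t : D t -> L (gamma t, velocity D gamma t) = 0.
  move=> Dt; have := gamma_lightlike _ Dt => /eqP.
  by rewrite mulf_eq0 -/(l t) gt_eqF ?l0//= => /eqP.
have hg' : admissible_curve A D' (gamma \o phi).
  split=> // s D's; rewrite vel//.
  exact: (conic_scale hA (hgA _ (phiD _ D's)) (l0 _ (phiD _ D's))).
split; last first.
  move=> s D's; rewrite vel//.
  have := finsler_homogeneous hL (hgA _ (phiD _ D's)) (l0 _ (phiD _ D's)).
  by rewrite /tscale /= L0 ?mulr0//; exact: phiD.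
split=> // s c D's cs.
have ctime u : chart_time D' (gamma \o phi) c u -> chart_time D gamma c (phi u).
  by move=> [D'u cu]; split => //; exact: phiD.
have cts : chart_time D' (gamma \o phi) c s by [].
have ct := ctime _ cts.
apply/(geodesic_euler_lagrange lD' hgs' hA hL hnablaL cts (hg'.2 _ D's)) => z.
have /(geodesic_euler_lagrange lD hgs hA hlL hnablalL ct (hgA _ (phiD _ D's))) := EL _ _ (phiD _ D's) cs.
move=> /(_ z) EG.
pose F := local_rep c L; pose Lam := local_rep c lambda.
pose N := local_rep c (fun v => lambda v * L v).
have Ddom u : chart_time D gamma c u -> local_dom c A (curve_lift D gamma c u).
  exact: curve_lift_dom.
(* The Leibniz rule on a lightlike vector, where L vanishes. *)
have DN v u : chart_time D gamma c u ->
    'D_v N (curve_lift D gamma c u) = l u * 'D_v F (curve_lift D gamma c u).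
  move=> cu; have [Du _] := cu; have Lu := Ddom _ cu.
  have dF : derivable F (curve_lift D gamma c u) v.
    by apply: diff_derivable; exact: (finsler_diff hL).
  have dLam : derivable Lam (curve_lift D gamma c u) v.
    by apply: diff_derivable; exact: (smooth_on_diff (lambda_smooth c)).
  have := deriveM dLam dF.
  rewrite /F /Lam !(local_rep_lift lD hg _ cu) (L0 _ Du) scale0r addr0.
  exact.
have lift' u : chart_time D' (gamma \o phi) c u ->
    curve_lift D' (gamma \o phi) c u =
    (chart c (gamma (phi u)), l (phi u) *: chart_velocity D gamma c (phi u)).
  by move=> cu; rewrite /curve_lift (reparam_chart_velocity lD lD' phiD phi_diff hgs hgs' cu).
have pos u : chart_time D' (gamma \o phi) c u -> 0 < l (phi u).
  by move=> /ctime[Du _]; exact: l0.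
have oE := chart_time_rel_open c hgs'.1.
apply: (rel_open_is_diff_in oE cts).
have dphi : is_diff_in (chart_time D' (gamma \o phi) c) s phi (fun h => h *: l (phi s)).
  by apply: is_diff_in_subset (phi_diff _ D's) => // u [].
(* The Euler-Lagrange equation of lambda L at the time phi s, composed with phi. *)
have d := is_diff_in_comp cts (fun u cu => (ctime u cu).1) dphi EG.
(* One factor comes from phi' and one from the metric lambda L. *)
have Fz : 'D_(z, 0) F (curve_lift D' (gamma \o phi) c s) =
    l (phi s) * (l (phi s) * 'D_(z, 0) F (curve_lift D gamma c (phi s))).
  rewrite lift'// mulrA -expr2.
  have := derive_homogeneous (local_dom_open hA (c := c)) (@local_dom_conic _ _ _ A c hA)
    z 0 (finsler_local_hom hL (c := c)) (finsler_diff hL (c := c)) (Ddom _ ct) (pos _ cts).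
  by rewrite scaler0.
have -> : (fun h : R => h *: 'D_(z, 0) (local_rep c L) (curve_lift D' (gamma \o phi) c s)) =
  (fun h => h *: 'D_(z, 0) N (curve_lift D gamma c (phi s))) \o (fun h => h *: l (phi s)).
  by apply/funext => h; rewrite /= Fz (DN _ _ ct) -scalerA.
(* Degree one in the fibre absorbs the factor lambda of the Euler-Lagrange
   function of lambda L into the velocity of the new curve. *)
apply: is_diff_in_subset d => // u cu /=.
rewrite (DN _ _ (ctime _ cu)) lift'//.
have := finsler_hom1 hA hL z (Ddom _ (ctime _ cu)) (pos _ cu).
by rewrite expr1.
Qed.
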